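(* There exists $f\in H^2_\tau(\mathcal S)$ admitting an uncountable family of Pauli partners $g\in H^2_\tau(\mathcal S)$, no two of which are constant multiples of one another.
   Context: $\mathcal S=\{z\in\mathbb C:|\mathrm{Im}\,z|<1\}$ is the strip, and $H^2_\tau(\mathcal S)$ is the space of holomorphic functions $f$ on $\mathcal S$ with $\sup_{|y|<1}\int_{\mathbb R}|f(t+iy)|^2\,\mathrm dt<\infty$; such functions restrict to functions in $L^2(\mathbb R)$, and the Fourier transform $\widehat f$ of this restriction is defined. A Pauli partner of $f$ is a function $g$ with $|g(x)|=|f(x)|$ for all $x\in\mathbb R$ and $|\widehat g(\xi)|=|\widehat f(\xi)|$ for all $\xi\in\mathbb R$. *)

(* Defs.v *)
From HB Require Import structures.
From mathcomp Require Import all_boot all_order all_algebra.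
From mathcomp Require Import all_classical all_reals all_analysis.
From mathcomp Require Import complex.
Set Implicit Arguments. Unset Strict Implicit. Unset Printing Implicit Defensive.
Import Order.TTheory GRing.Theory Num.Theory.
Import numFieldNormedType.Exports.
Local Open Scope classical_set_scope.
Local Open Scope ring_scope.

Definition strip (R : realType) : set R[i] := [set z | `|complex.Im z| < 1].

(* Complex differentiability at every point of D (h ranges over nonzero
   complex numbers, since R[i] is a normed module over itself). *)
Definition holomorphic_on (R : realType) (D : set R[i]) (f : R[i] -> R[i]) :=
  forall z, D z -> derivable (f : R[i]^o -> R[i]^o) z 1.

Definition H2_strip (R : realType) (f : R[i] -> R[i]) :=
  holomorphic_on (@strip R) f /\
  exists M : R, forall y : R, `|y| < 1 ->
    (\int[@lebesgue_measure R]_t ((Normc.normc (f (Complex t y))) ^+ 2)%:E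
       <= M%:E)%E.

Definition cexpi (R : realType) (t : R) : R[i] := Complex (cos t) (sin t).

Definition fourier_trunc (R : realType) (g : R -> R[i]) (N : nat) (xi : R)
  : R[i] :=
  Complex
    (Rintegral (@lebesgue_measure R) `[- (N%:R), N%:R]%classic
       (fun x => complex.Re (g x * cexpi (- (x * xi)))))
    (Rintegral (@lebesgue_measure R) `[- (N%:R), N%:R]%classic
       (fun x => complex.Im (g x * cexpi (- (x * xi))))).

(* G is (a representative of) the L^2(R) Fourier transform of g:
   G is measurable, square integrable, and the truncated Fourier integrals
   of g converge to G in L^2 (Plancherel). *)
Definition is_L2_fourier (R : realType) (g : R -> R[i]) (G : R -> R[i]) :=
  [/\ measurable_fun setT (fun xi => complex.Re (G xi)),
      measurable_fun setT (fun xi => complex.Im (G xi)),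
      (\int[@lebesgue_measure R]_xi ((Normc.normc (G xi)) ^+ 2)%:E < +oo)%E &
      ((fun N : nat => (\int[@lebesgue_measure R]_(xi in setT)
          ((Normc.normc (G xi - fourier_trunc g N xi)) ^+ 2)%:E)%E) : nat -> \bar R)
        @ \oo --> (0 : \bar R)].

Definition restrR (R : realType) (f : R[i] -> R[i]) : R -> R[i] :=
  fun x => f (Complex x 0).

(* g is a Pauli partner of f: |g| = |f| on R and |g^| = |f^| on R
   (for suitable representatives of the L^2 Fourier transforms). *)
Definition pauli_partner (R : realType) (f g : R[i] -> R[i]) :=
  (forall x : R, Normc.normc (g (Complex x 0)) = Normc.normc (f (Complex x 0))) /\
  exists F G : R -> R[i],
    [/\ is_L2_fourier (restrR f) F, is_L2_fourier (restrR g) G &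
        forall xi : R, Normc.normc (G xi) = Normc.normc (F xi)].

(* Main.v *)
(** The functions are f_e = phi * p_e for sign sequences e : nat -> bool, where
    phi(x) = 2 (1 - cos x) / x^2 has Fourier transform supported in [-1, 1] and
    p_e(x) = prod_k (1 + i s_k a_k sin(4^(k+1) x)), with s_k = 1 or -1 according
    to e k and a_k = exp(- 4^(k+2)) / 2^(k+1), is a Riesz product.

    Flipping a sign s_k conjugates a factor on the real line, so |f_e| does not
    depend on e there.  Expanding, p_e = sum_n c_n exp(i mu_n x), where flipping
    signs changes only the signs of the real coefficients c_n, and the
    frequencies mu_n are 4-separated.  The Fourier transform of f_e is thus a
    sum of translates, with disjoint supports, of that of phi with coefficients
    c_n, and its modulus does not depend on e either.  The a_k decay so fast
    that the expansion converges normally on |Im z| <= 4.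

    At x = pi / (2 * 4^(k+1)) all factors of index j > k are equal to 1 and the
    k-th one is 1 + i s_k a_k; evaluating there and at 0 recovers e from any
    nonzero multiple of f_e.

    The transform of phi needs neither Plancherel nor the value of the Dirichlet
    integral: truncated to [-N, N] it is a second difference of u K(u) with
    K(u) = int_{-u}^{u} (1 - cos x) / x^2 dx, and
    u K(u) = C |u| - 2 + O(1 / (1 + |u|)), so it is
    C (|xi + 1| + |xi - 1| - 2 |xi|) up to O(1 / (N (1 + |xi|))). *)

Require Import Defs.
From HB Require Import structures.
From mathcomp Require Import all_boot all_order all_algebra.
From mathcomp Require Import all_classical all_reals all_analysis.
From mathcomp Require Import measurable_realfun complex.
From mathcomp Require Import ring lra zify.
Set Implicit Arguments. Unset Strict Implicit. Unset Printing Implicit Defensive.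
Import Order.TTheory GRing.Theory Num.Theory.
Import numFieldNormedType.Exports.
Local Open Scope classical_set_scope.
Local Open Scope ring_scope.

(** * Taylor bounds *)

Section real_bounds.
Context {R : realType}.
Implicit Types x y : R.

Lemma is_derive_continuous (f df : R -> R) :
  (forall x, is_derive x 1 f (df x)) -> continuous f.
Proof.
by move=> fdf x; apply/differentiable_continuous/derivable1_diffP;
  have [] := fdf x.
Qed.

Lemma ge0_derive_homo (f df : R -> R) (a b : R) : a <= b ->
  (forall x, a <= x <= b -> is_derive x 1 f (df x)) ->
  (forall x, a <= x <= b -> 0 <= df x) -> f a <= f b.
Proof.
move=> ab fdf df0.
have [x||c] := @MVT_segment R f df a b ab; last first.
- by rewrite in_itv /= => cab e; rewrite -subr_ge0 e mulr_ge0 ?subr_ge0 ?df0.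
- apply: derivable_within_continuous => x; rewrite in_itv/= => xab.
  by have [] := fdf x xab.
- by rewrite in_itv /= => /andP[/ltW ax /ltW xb]; apply: fdf; rewrite ax xb.
Qed.

(** Drives the Taylor bounds below: the difference of the two sides is nonnegative at 0, and its
    derivative is nonnegative by an earlier or elementary bound. *)
Lemma ge0_derive (f df : R -> R) : (forall x, is_derive x 1 f (df x)) ->
  (forall x, 0 <= x -> 0 <= df x) -> 0 <= f 0 -> forall x, 0 <= x -> 0 <= f x.
Proof.
move=> fdf df0 f0 x x0; apply: (le_trans f0).
by apply: (@ge0_derive_homo f df _ _ x0) => // y /andP[y0 _]; exact: df0.
Qed.

Lemma sin_lex x : 0 <= x -> sin x <= x.
Proof.
move=> x0; rewrite -subr_ge0; move: x x0.
have D (y : R) : is_derive y 1 (fun x => x - sin x)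
    ((fun x => 1 - cos x) y).
  by apply: is_derive_eq.
apply: (ge0_derive D) => [y y0|].
- by rewrite subr_ge0 cos_le1.
- by rewrite sin0 subr0.
Qed.

Lemma onesubcos_lex x : 0 <= x -> 1 - cos x <= x.
Proof.
move=> x0; rewrite -subr_ge0; move: x x0.
have D (y : R) : is_derive y 1 (fun x => x - (1 - cos x))
    ((fun x => 1 - sin x) y).
  by apply: is_derive_eq; ring.
apply: (ge0_derive D) => [y y0|].
- by rewrite subr_ge0 sin_le1.
- by rewrite cos0 subrr subr0.
Qed.

Lemma onesubcos_le_sqr x : 0 <= x -> 1 - cos x <= x ^+ 2 / 2.
Proof.
move=> x0; rewrite -subr_ge0; move: x x0.
have D (y : R) : is_derive y 1 (fun x => x ^+ 2 / 2 - (1 - cos x))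
    ((fun x => x - sin x) y).
  by apply: is_derive_eq; rewrite /GRing.scale /=; field.
apply: (ge0_derive D).
- by move=> y y0; rewrite subr_ge0 sin_lex.
- by rewrite cos0 subrr subr0 expr0n mul0r.
Qed.

Lemma xsubsin_le_sqr x : 0 <= x -> x - sin x <= x ^+ 2 / 2.
Proof.
move=> x0; rewrite -subr_ge0; move: x x0.
have D (y : R) : is_derive y 1 (fun x => x ^+ 2 / 2 - (x - sin x))
    ((fun x => x - (1 - cos x)) y).
  by apply: is_derive_eq; rewrite /GRing.scale /=; field.
apply: (ge0_derive D).
- by move=> y y0; rewrite subr_ge0 onesubcos_lex.
- by rewrite sin0 !subr0 expr0n mul0r.
Qed.

Lemma xsubsin_le_cube x : 0 <= x -> x - sin x <= x ^+ 3.
Proof.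
move=> x0; rewrite -subr_ge0; move: x x0.
have D (y : R) : is_derive y 1 (fun x => x ^+ 3 - (x - sin x))
    ((fun x => 3 * x ^+ 2 - (1 - cos x)) y).
  by apply: is_derive_eq; rewrite /GRing.scale /=; ring.
apply: (ge0_derive D).
- by move=> y y0; have := onesubcos_le_sqr y0; nra.
- by rewrite sin0 !subr0 expr0n.
Qed.

Lemma cos_taylor_le_cube x : 0 <= x -> 0 <= cos x - 1 + x ^+ 2 / 2 <= x ^+ 3.
Proof.
move=> x0; apply/andP; split.
  by have := onesubcos_le_sqr x0; lra.
rewrite -subr_ge0; move: x x0.
have D (y : R) : is_derive y 1 (fun x => x ^+ 3 - (cos x - 1 + x ^+ 2 / 2))
    ((fun x => 3 * x ^+ 2 - (x - sin x)) y).
  by apply: is_derive_eq; rewrite /GRing.scale /=; field.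
apply: (ge0_derive D).
- by move=> y y0; have := xsubsin_le_sqr y0; nra.
- by rewrite cos0 subrr add0r !expr0n /= mul0r subrr.
Qed.

Lemma normr_cosB1_le_sqr x : `|cos x - 1| <= x ^+ 2.
Proof.
wlog x0 : x / 0 <= x => [H|].
  have [/H//|x0] := leP 0 x; rewrite -sqrrN -cosN; apply: H.
  by rewrite oppr_ge0 ltW.
have := onesubcos_le_sqr x0; have := cos_le1 x; rewrite ler_norml; nra.
Qed.

Lemma normr_cosB1 x : `|cos x - 1| <= `|x|.
Proof.
wlog x0 : x / 0 <= x => [H|].
  have [/H//|x0] := leP 0 x; rewrite -normrN -[`|x|]normrN -cosN normrN.
  by apply: H; rewrite oppr_ge0 ltW.
by rewrite (ger0_norm x0); have := onesubcos_lex x0; have := cos_le1 x;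
  rewrite ler_norml; lra.
Qed.

Lemma normr_sin_le x : `|sin x| <= `|x|.
Proof.
wlog x0 : x / 0 <= x => [H|].
  have [/H//|x0] := leP 0 x; rewrite -normrN -[`|x|]normrN -sinN.
  by apply: H; rewrite oppr_ge0 ltW.
have [x1|x1] := leP 1 x.
  by rewrite (ger0_norm x0) (le_trans (sin_max x)).
rewrite (ger0_norm x0); have := sin_lex x0.
have := xsubsin_le_sqr x0; rewrite ler_norml; nra.
Qed.

Lemma normr_sinBx_le_sqr x : `|sin x - x| <= x ^+ 2.
Proof.
wlog x0 : x / 0 <= x => [H|].
  have [/H//|x0] := leP 0 x; rewrite -sqrrN.
  have -> : sin x - x = - (sin (- x) - - x) by rewrite sinN; ring.
  rewrite normrN.
  by apply: H; rewrite oppr_ge0 ltW.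
have := xsubsin_le_sqr x0; have := sin_lex x0; rewrite ler_norml; nra.
Qed.

Lemma normr_sinBx_le_cube x : `|sin x - x| <= `|x| ^+ 3.
Proof.
wlog x0 : x / 0 <= x => [H|].
  have [/H//|x0] := leP 0 x; rewrite -[`|x|]normrN.
  have -> : sin x - x = - (sin (- x) - - x) by rewrite sinN; ring.
  rewrite [leLHS]normrN.
  by apply: H; rewrite oppr_ge0 ltW.
rewrite (ger0_norm x0); have := xsubsin_le_cube x0; have := sin_lex x0.
have := exprn_ge0 3 x0; rewrite ler_norml; lra.
Qed.

Lemma normr_cos_taylor x : `|cos x - 1 + x ^+ 2 / 2| <= `|x| ^+ 3.
Proof.
wlog x0 : x / 0 <= x => [H|].
  have [/H//|x0] := leP 0 x; rewrite -[`|x|]normrN -cosN -(sqrrN x).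
  by apply: H; rewrite oppr_ge0 ltW.
by have /andP[c0 c1] := cos_taylor_le_cube x0; rewrite (ger0_norm x0) ger0_norm.
Qed.

Lemma normr_expRB1 x : `|expR x - 1| <= `|x| * expR `|x|.
Proof.
have [x0|x0] := leP 0 x.
  rewrite (ger0_norm x0) ger0_norm ?subr_ge0 -?expR0 ?ler_expR//.
  have := expR_ge1Dx (- x); have := expR_gt0 x; have := expRxMexpNx_1 x.
  rewrite expR0; nra.
rewrite (ltr0_norm x0) ler0_norm ?subr_le0 -?expR0 ?ler_expR ?ltW//.
have := expR_ge1Dx x; have := expR_ge1Dx (- x); rewrite expR0; nra.
Qed.

Lemma expRN_taylor2_le x : 0 <= x -> expR (- x) - 1 + x <= x ^+ 2.
Proof.
move=> x0; rewrite -subr_ge0; move: x x0.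
have D (y : R) : is_derive y 1 (fun x => x ^+ 2 - (expR (- x) - 1 + x))
    ((fun x => 2 * x + expR (- x) - 1) y).
  by apply: is_derive_eq; rewrite /GRing.scale /=; ring.
apply: (ge0_derive D).
- by move=> y y0; have := expR_ge1Dx (- y); lra.
- by rewrite expr0n oppr0 expR0 /=; lra.
Qed.

Lemma expR_taylor2 x : `|expR x - 1 - x| <= x ^+ 2 * expR `|x|.
Proof.
rewrite ger0_norm; last by have := expR_ge1Dx x; lra.
have H y : 0 <= y -> expR y - 1 - y <= y ^+ 2 * expR y.
  move=> y0; rewrite -subr_ge0; move: y y0.
  have D (y : R) : is_derive y 1 (fun x => x ^+ 2 * expR x - (expR x - 1 - x))
      ((fun x => 2 * x * expR x + x ^+ 2 * expR x - (expR x - 1)) y).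
    by apply: is_derive_eq; rewrite /GRing.scale /=; ring.
  apply: (ge0_derive D).
  - move=> y y0; have := normr_expRB1 y; rewrite (ger0_norm y0) ler_norml.
    have : 0 <= y * expR y by rewrite mulr_ge0 ?expR_ge0.
    have : 0 <= y ^+ 2 * expR y by rewrite mulr_ge0 ?expR_ge0 ?sqr_ge0.
    by lra.
  - by rewrite expr0n expR0 /= mul0r; lra.
have [x0|x0] := leP 0 x; first by rewrite (ger0_norm x0); exact: H.
rewrite (ltr0_norm x0).
have := @expRN_taylor2_le (- x); rewrite opprK sqrrN => /(_ _)/wrap[]; first by lra.
move=> H1; apply: (le_trans H1); rewrite ler_peMr ?sqr_ge0//.
by rewrite -expR0 ler_expR; lra.
Qed.

Lemma expR_taylor3 x : `|expR x - 1 - x - x ^+ 2 / 2| <= `|x| ^+ 3 * expR `|x|.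
Proof.
have [x0|x0] := leP 0 x.
  rewrite (ger0_norm x0) ger0_norm.
    rewrite -subr_ge0; move: x x0.
    have D (y : R) : is_derive y 1 (fun x => x ^+ 3 * expR x - (expR x - 1 - x - x ^+ 2 / 2))
        ((fun x => 3 * x ^+ 2 * expR x + x ^+ 3 * expR x - (expR x - 1 - x)) y).
      by apply: is_derive_eq; rewrite /GRing.scale /=; field.
    apply: (ge0_derive D).
    - move=> y y0; have := expR_taylor2 y; rewrite (ger0_norm y0) ler_norml.
      have : 0 <= y ^+ 3 * expR y by rewrite mulr_ge0 ?expR_ge0 ?exprn_ge0.
      have : 0 <= y ^+ 2 * expR y by rewrite mulr_ge0 ?expR_ge0 ?sqr_ge0.
      by lra.
    - by rewrite !expr0n expR0 /= !mul0r; lra.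
  move: x x0.
  have D (y : R) : is_derive y 1 (fun x => (expR x - 1 - x - x ^+ 2 / 2))
      ((fun x => (expR x - 1 - x)) y).
    by apply: is_derive_eq; rewrite /GRing.scale /=; field.
  apply: (ge0_derive D).
  - by move=> y y0; have := expR_ge1Dx y; lra.
  - by rewrite !expr0n expR0 /= !mul0r; lra.
rewrite (ltr0_norm x0).
have {x0} : 0 < - x by lra.
rewrite -[in X in X <= _](opprK x); move: (- x) => {}x /ltW x0.
(* For a negative argument the cube alone bounds the remainder, and the exponential factor of the
   claim is at least 1. *)
suff H : 0 <= - (expR (- x) - 1 - (- x) - (- x) ^+ 2 / 2) <= x ^+ 3.
  case/andP: H => H1 H2; rewrite ler0_norm; last by lra.
  apply: (le_trans H2); rewrite ler_peMr ?exprn_ge0//.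
  by rewrite -expR0 ler_expR.
have e2 y : 0 <= y -> 0 <= expR (- y) - 1 + y.
  by move=> _; have := expR_ge1Dx (- y); lra.
apply/andP; split.
  move: x x0.
  have D (y : R) : is_derive y 1 (fun x => - (expR (- x) - 1 - (- x) - (- x) ^+ 2 / 2))
      ((fun x => expR (- x) - 1 + x) y).
    by apply: is_derive_eq; rewrite /GRing.scale /=; field.
  apply: (ge0_derive D).
  - by [].
  - by rewrite !oppr0 !expr0n expR0 /= !mul0r; lra.
rewrite -subr_ge0; move: x x0.
have D (y : R) : is_derive y 1 (fun x => x ^+ 3 - - (expR (- x) - 1 - (- x) - (- x) ^+ 2 / 2))
    ((fun x => 3 * x ^+ 2 - (expR (- x) - 1 + x)) y).
  by apply: is_derive_eq; rewrite /GRing.scale /=; field.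
apply: (ge0_derive D).
- by move=> y y0; have := expRN_taylor2_le y0; nra.
- by rewrite !oppr0 !expr0n expR0 /= !mul0r; lra.
Qed.

End real_bounds.

(** * Integrals over the line and over segments *)

Section integrals.
Context {R : realType}.
Notation mu := (@lebesgue_measure R).

(** The integral of a nonnegative function is a supremum over the simple functions below it, so
    monotonicity is an inclusion between sets of simple functions. The L2 bounds below thus rest on
    pointwise estimates alone. *)
Lemma ge0_le_integralT (f g : R -> \bar R) : (forall x, 0 <= f x)%E ->
  (forall x, f x <= g x)%E -> (\int[mu]_x f x <= \int[mu]_x g x)%E.
Proof.
move=> f0 fg; rewrite !ge0_integralTE// => [|x]; last exact: le_trans (fg x).
apply: le_ereal_sup => _ [h hf <-]; exists h => // x.
exact: le_trans (hf x) (fg x).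
Qed.

Lemma integral_oneDsqrV : (\int[mu]_x ((oneDsqr x)^-1)%:E = (pi : R)%:E)%E.
Proof.
rewrite (@ge0_symfun_integralT R (fun x => (oneDsqr x)^-1)).
- rewrite -set_itvcy integral0y_oneDsqr -EFinM; congr (_%:E); lra.
- by move=> x; rewrite invr_ge0; apply: le_trans (oneDsqr_ge1 x).
- exact: continuous_oneDsqrV.
- by move=> x /=; rewrite /oneDsqr sqrrN.
Qed.

Lemma le_integral_oneDsqrV (f : R -> R) (D : R) : 0 <= D ->
  (forall x, 0 <= f x <= D * (oneDsqr x)^-1) ->
  (\int[mu]_x (f x)%:E <= (D * pi)%:E)%E.
Proof.
move=> D0 fD; apply: (@le_trans _ _ (\int[mu]_x (D%:E * ((oneDsqr x)^-1)%:E))%E).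
  by apply: ge0_le_integralT => x; rewrite ?lee_fin; case/andP : (fD x).
rewrite ge0_integralZl//.
- by rewrite integral_oneDsqrV.
- apply/measurable_EFinP; apply: continuous_measurable_fun.
  exact: continuous_oneDsqrV.
Qed.

Lemma integrable_le_oneDsqrV (f : R -> R) (D : R) (A : set R) :
  measurable A -> continuous f ->
  (forall x, `|f x| <= D * (oneDsqr x)^-1) -> mu.-integrable A (EFin \o f).
Proof.
move=> mA cf fD; apply: (@integrableS _ _ _ _ setT) => //.
have mf : measurable_fun [set: R] (EFin \o f).
  by apply/measurable_EFinP; exact: continuous_measurable_fun.
apply/integrableP; split => //=.
have D0 : 0 <= D.
  have := le_trans (normr_ge0 _) (fD 0); rewrite /oneDsqr expr0n addr0 invr1.
  by rewrite mulr1.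
apply: (@le_lt_trans _ _ (D * pi)%:E); last exact: ltry.
by apply: le_integral_oneDsqrV => // x; rewrite normr_ge0 fD.
Qed.

(** Integrating from [-oo] gives one formula that can be differentiated at every point of the
    line. *)
Lemma derive_antiderivative (f : R -> R) : continuous f ->
  (forall A, measurable A -> mu.-integrable A (EFin \o f)) ->
  exists J : R -> R, forall x : R, is_derive x 1 J (f x).
Proof.
move=> cf fi; exists (fun x => Rintegral mu `]-oo, x]%classic f) => x.
have := @continuous_FTC1 R f -oo%O x (x + 1) _ (fi _ _) _ (cf x).
case=> //; rewrite ?ltrDl ?ltNyr//.
by move=> d e; apply: DeriveDef => //; rewrite -derive1E.
Qed.

Lemma Rintegral_derive (f F : R -> R) (a b : R) : a < b -> continuous f ->
  (forall x : R, is_derive x 1 F (f x)) ->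
  Rintegral mu `[a, b]%classic f = F b - F a.
Proof.
move=> ab cf FF; rewrite /Rintegral (@continuous_FTC2 R f F a b)//.
- exact: continuous_subspaceT.
- have cF := is_derive_continuous FF.
  split.
  + by move=> x _; have [] := FF x.
  + by apply: cvg_at_right_filter; exact: cF.
  + by apply: cvg_at_left_filter; exact: cF.
- by move=> x _; rewrite derive1E; have [_ ->] := FF x.
Qed.

Lemma Rintegral_odd (f : R -> R) (a : R) : 0 <= a -> continuous f ->
  (forall x, f (- x) = - f x) -> Rintegral mu `[- a, a]%classic f = 0.
Proof.
move=> a0 cf fN.
have cw A : {within A, continuous f} by exact: continuous_subspaceT.
have itf : mu.-integrable `[- a, a]%classic (EFin \o f).
  apply: continuous_compact_integrable => //; exact: segment_compact.
have H0 (u : R) : u = - u -> u = 0 by lra.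
suff H : Rintegral mu `[- a, a]%classic f = - Rintegral mu `[- a, a]%classic f.
  exact: H0.
have := @integration_by_substitution_oppr R f (- a) a.
rewrite opprK => /(_ _ (cw _))/wrap[]; first by lra.
rewrite {1}/Rintegral => ->.
rewrite -[RHS]mulN1r -(@RintegralZl _ _ R mu _ f (-1))//; congr fine; apply: eq_integral => x _ /=.
by rewrite fN mulN1r.
Qed.
End integrals.

(** * The Fourier transform of the kernel *)

Section kernel.
Context {R : realType}.
Notation mu := (@lebesgue_measure R).
Implicit Types x u xi : R.

(** Half of phi, that is, half the square of [sin (x / 2) / (x / 2)], with its limit as the value at
    0. *)
Definition kern (x : R) : R := if x == 0 then 2^-1 else (1 - cos x) / x ^+ 2.

Lemma kern0 : kern 0 = 2^-1. Proof. by rewrite /kern eqxx. Qed.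

Lemma kernE x : x != 0 -> kern x = (1 - cos x) / x ^+ 2.
Proof. by rewrite /kern => /negbTE ->. Qed.

Lemma kern_even x : kern (- x) = kern x.
Proof. by rewrite /kern oppr_eq0 cosN sqrrN. Qed.

Lemma kern_ge0 x : 0 <= kern x.
Proof.
rewrite /kern; case: ifP => [|x0]; first by rewrite invr_ge0.
by rewrite divr_ge0 ?subr_ge0 ?cos_le1 ?sqr_ge0.
Qed.

(** This is the third-order Taylor remainder of the cosine divided by [x ^+ 2]; it yields continuity
    at 0. *)
Lemma kern_near0 x : `|kern x - 2^-1| <= `|x|.
Proof.
have [->|x0] := eqVneq x 0; first by rewrite kern0 subrr normr0.
rewrite kernE//; have x2 : 0 < x ^+ 2 by rewrite exprn_even_gt0.
have -> : (1 - cos x) / x ^+ 2 - 2^-1 = - (cos x - 1 + x ^+ 2 / 2) / x ^+ 2.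
  by field.
rewrite mulNr normrN normrM normfV (ger0_norm (ltW x2)) ler_pdivrMr//.
apply: (le_trans (normr_cos_taylor x)).
by rewrite -(real_normK (num_real x)) exprS.
Qed.

Lemma kern_le x : kern x <= 4 * (oneDsqr x)^-1.
Proof.
have [->|x0] := eqVneq x 0; first by rewrite kern0 /oneDsqr expr0n addr0; lra.
have x2 : 0 < x ^+ 2 by rewrite exprn_even_gt0.
rewrite kernE// ler_pdivrMr//.
have -> : 4 * (oneDsqr x)^-1 * x ^+ 2 = 4 * x ^+ 2 / oneDsqr x by ring.
rewrite ler_pdivlMr /oneDsqr; last by lra.
have := normr_cosB1_le_sqr x; have := cos_geN1 x; have := cos_le1 x.
by rewrite ler_norml; nra.
Qed.

Lemma continuous_kern : continuous kern.
Proof.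
move=> x; have [->|x0] := eqVneq x 0.
  rewrite /continuous_at kern0; apply/cvgrPdist_le => e e0.
  have : \forall y \near (0 : R), `|y| <= e.
    by exists e => //= y; rewrite /= sub0r normrN => /ltW.
  by apply: filterS => y ye; rewrite distrC (le_trans (kern_near0 y)).
have : {for x, continuous (fun y : R => (1 - cos y) / y ^+ 2)}.
  apply: cvgM.
    by apply: cvgB; [exact: cvg_cst|exact: continuous_cos].
  by apply: cvgV; [rewrite sqrf_eq0|exact: exprn_continuous].
rewrite /prop_for /continuous_at => H.
rewrite (kernE x0); apply: cvg_trans H; apply: near_eq_cvg.
near=> y; rewrite kernE//; near: y.
exact: (@open_neq R 0).
Unshelve. all: by end_near. Qed.

Lemma continuous_kernM (t : R -> R) (a : R) : continuous t ->
  continuous (fun x => 2 * kern x * t (x * a)).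
Proof.
move=> ct x; apply: cvgM; first by apply: cvgM; [exact: cvg_cst|
  exact: continuous_kern].
apply: (@continuous_comp _ _ _ (fun x => x * a) t).
  by apply: cvgM; [exact: cvg_id|exact: cvg_cst].
exact: ct.
Qed.

Lemma integrable_kern (A : set R) : measurable A ->
  mu.-integrable A (EFin \o kern).
Proof.
move=> mA; apply: (@integrable_le_oneDsqrV R _ 4) => //.
  exact: continuous_kern.
by move=> x; rewrite (ger0_norm (kern_ge0 x)) kern_le.
Qed.

Lemma sqr_kern (a x : R) : x != 0 ->
  a ^+ 2 * kern (a * x) = (1 - cos (a * x)) / x ^+ 2.
Proof.
move=> x0; have [->|a0] := eqVneq a 0.
  by rewrite expr0n mul0r !mul0r cos0 subrr mul0r.
by rewrite kernE ?mulf_neq0//; field; rewrite a0 x0.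
Qed.

(** This is [cos((xi+1)x) + cos((xi-1)x) - 2 cos(xi x) = -2 (1 - cos x) cos(xi x)], up to sign and
    division by [x ^+ 2]. It writes the Fourier integrand of phi as a combination of dilates of
    [kern]. *)
Lemma kern_second_difference xi x :
  (xi + 1) ^+ 2 * kern ((xi + 1) * x) + (xi - 1) ^+ 2 * kern ((xi - 1) * x)
   - 2 * (xi ^+ 2 * kern (xi * x)) = 2 * kern x * cos (x * xi).
Proof.
have [->|x0] := eqVneq x 0.
  by rewrite !mulr0 mul0r kern0 cos0; field.
rewrite !sqr_kern// kernE// [x * xi]mulrC (mulrDl xi 1) (mulrBl x xi) mul1r cosD cosB.
by field.
Qed.

(** By the second difference identity, a single primitive of [kern], suitably rescaled, integrates
    the truncated transform exactly for every [xi]. *)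
Lemma fourier_trunc_kern : exists2 K : R -> R,
  [/\ K 0 = 0, forall u, K (- u) = - K u &
      forall u, is_derive u 1 K (2 * kern u)] &
  forall a xi, 0 < a ->
  Rintegral mu `[- a, a]%classic (fun x => 2 * kern x * cos (x * xi)) =
  (xi + 1) * K ((xi + 1) * a) + (xi - 1) * K ((xi - 1) * a)
    - 2 * (xi * K (xi * a)).
Proof.
have [J dJ] := derive_antiderivative continuous_kern integrable_kern.
(* The integral of [kern] from [- u] to [u], for either sign of [u]. *)
exists (fun u => J u - J (- u)).
  split => [|u|u]; first by rewrite oppr0 subrr.
    by rewrite opprK opprB.
  have dJN : is_derive u 1 (J \o -%R) (kern (- u) * - 1).
    by apply: is_derive1_comp.
  apply: is_derive_eq; rewrite kern_even; ring.
move=> a xi a0.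
have dJm (c x : R) : is_derive x 1 (fun x => J (c * x)) (kern (c * x) * c).
  apply: (@is_derive1_comp R J (fun x => c * x)).
  by apply: is_derive_eq; rewrite /GRing.scale /=; ring.
(* A primitive of the integrand; its increment over [[- a, a]] pairs [J (c * a)] with
   [J (- (c * a))] into [K (c * a)]. *)
pose V (x : R) := (xi + 1) * J ((xi + 1) * x)
  + (xi - 1) * J ((xi - 1) * x) - 2 * (xi * J (xi * x)).
have dV (x : R) : is_derive x 1 V (2 * kern x * cos (x * xi)).
  apply: is_derive_eq; rewrite /GRing.scale /=.
  by rewrite -kern_second_difference; ring.
rewrite (Rintegral_derive _ _ dV).
- by rewrite /V !mulrN; ring.
- by lra.
- by apply: continuous_kernM; exact: continuous_cos.
Qed.

End kernel.

(** * Asymptotics of the primitive of the kernel, and the triangular limit of its truncated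
    transforms *)

Section asymptotics.
Context {R : realType}.
Notation mu := (@lebesgue_measure R).
Implicit Types x u v xi : R.

(** On the positive half-line a corrected primitive [B] has [B - 2 / u^2] increasing and
    [B + 2 / u^2] decreasing, so [B] is within [2 / u^2] of a constant [C]. Multiplication by [u]
    gives the expansion, the term [2 / u] of [B] accounting for the constant 2. *)
Lemma kern_primitive_asymptotics (K : R -> R) :
  K 0 = 0 -> (forall u, K (- u) = - K u) ->
  (forall u, is_derive u 1 K (2 * kern u)) ->
  exists C c : R, forall u, `|u * K u - C * `|u| + 2| <= c * (1 + `|u|)^-1.
Proof.
move=> K0 KN dK.
(* The last two terms cancel all of K' but an error O(u^-3). *)
pose B u := K u + 2 * u^-1 + 2 * (sin u * (u ^+ 2)^-1).
have dB (s u : R) : u != 0 -> is_derive u 1 (fun u => B u - s * (u ^+ 2)^-1)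
    ((2 * s - 4 * sin u) / u ^+ 3).
  move=> u0; have u20 : u ^+ 2 != 0 by rewrite sqrf_eq0.
  have d1 : is_derive u 1 (fun u : R => u^-1) (- (u ^+ 2)^-1 *: 1).
    exact: is_deriveV.
  have d2 : is_derive u 1 (fun u : R => (u ^+ 2)^-1)
     (- ((u ^+ 2) ^+ 2)^-1 *: (2 * u)).
    apply: is_deriveV => //; apply: is_derive_eq.
    by rewrite /GRing.scale /=; ring.
  apply: is_derive_eq; rewrite kernE// /GRing.scale /=.
  by field.
have lo u v : 0 < u -> u <= v -> B u - 2 * (u ^+ 2)^-1 <= B v - 2 * (v ^+ 2)^-1.
  move=> u0 uv; apply: (@ge0_derive_homo R (fun u => B u - 2 * (u ^+ 2)^-1)
    (fun u => (2 * 2 - 4 * sin u) / u ^+ 3)) => // x /andP[ux _].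
    by apply: dB; lra.
  have x0 : 0 <= x by lra.
  by rewrite divr_ge0 ?exprn_ge0//; have := sin_le1 x; lra.
have hi u v : 0 < u -> u <= v -> B v + 2 * (v ^+ 2)^-1 <= B u + 2 * (u ^+ 2)^-1.
  move=> u0 uv; rewrite -lerN2.
  have dBN (x : R) : x != 0 -> is_derive x 1 (fun u => - (B u + 2 * (u ^+ 2)^-1))
      ((4 + 4 * sin x) / x ^+ 3).
    move=> x0; have := is_deriveN (dB (-2) x x0).
    rewrite (_ : - _ = (fun u => - (B u + 2 * (u ^+ 2)^-1))); last first.
      by apply/funext => y; rewrite !fctE mulNr opprK.
    by move=> H; apply: is_derive_eq; ring.
  apply: (@ge0_derive_homo R (fun u => - (B u + 2 * (u ^+ 2)^-1))
    (fun u => (4 + 4 * sin u) / u ^+ 3)) => // x /andP[ux _].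
    by apply: dBN; lra.
  have x0 : 0 <= x by lra.
  by rewrite divr_ge0 ?exprn_ge0//; have := sin_geN1 x; lra.
have sq u : 0 < u -> 0 < (u ^+ 2)^-1 by move=> u0; rewrite invr_gt0 exprn_gt0.
have lohi u v : 0 < u -> 0 < v -> B u - 2 * (u ^+ 2)^-1 <= B v + 2 * (v ^+ 2)^-1.
  move=> u0 v0; have := sq u u0; have := sq v v0; have [uv|/ltW uv] := leP u v.
    by have := lo u v u0 uv; lra.
  by have := hi v u v0 uv; lra.
(* [C] is the limit of [B] at infinity, obtained as the supremum of the lower bounds; by [lohi]
   every upper bound lies above it. *)
pose E := [set B u - 2 * (u ^+ 2)^-1 | u in [set u : R | 0 < u]].
have supE : has_sup E.
  split; first by exists (B 1 - 2 * (1 ^+ 2)^-1), 1 => //=.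
  by exists (B 1 + 2 * (1 ^+ 2)^-1) => _ [u /= u0 <-]; apply: lohi.
pose C := sup E.
have CB u : 0 < u -> `|B u - C| <= 2 * (u ^+ 2)^-1.
  move=> u0; have h1 : B u - 2 * (u ^+ 2)^-1 <= C.
    by apply: sup_upper_bound => //; exists u.
  have h2 : C <= B u + 2 * (u ^+ 2)^-1.
    by apply: sup_le_ub; [case: supE|move=> _ [v /= v0 <-]; exact: lohi].
  by rewrite ler_norml; lra.
(* The 8 serves [1 <= u], where the error is at most [4 / u] and [1 + u <= 2 * u]; the rest serves
   [u < 1], where [K u <= K 1] and [1 + u <= 2]. *)
exists C, (8 + 2 * (K 1 + `|C| + 2)) => u.
wlog u0 : u / 0 <= u => [H|].
  have [/H//|u0] := leP 0 u.
  have := H (- u); rewrite KN mulrNN normrN; apply; lra.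
rewrite (ger0_norm u0).
have Knd x y : 0 <= x -> x <= y -> K x <= K y.
  move=> x0 xy; apply: (@ge0_derive_homo R K (fun u => 2 * kern u)) => // z _.
  by rewrite mulr_ge0// kern_ge0.
have K10 : 0 <= K 1 by rewrite -K0 Knd.
rewrite ler_pdivlMr; last by lra.
have [u1|u1] := leP 1 u.
  have up : 0 < u by lra.
  have : `|u * K u - C * u + 2| <= 4 / u.
    have -> : u * K u - C * u + 2 = u * (B u - C) - 2 * sin u / u.
      by rewrite /B; field; lra.
    apply: (le_trans (ler_normB _ _)).
    rewrite !normrM normfV (gtr0_norm up) (ger0_norm (_ : 0 <= 2))//.
    have := sin_max u; have := CB u up => h1 h2.
    have i0 : 0 < u^-1 by rewrite invr_gt0.
    have : u * `|B u - C| <= 2 / u.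
      apply: (le_trans (ler_wpM2l u0 h1)); rewrite le_eqVlt; apply/orP; left.
      by apply/eqP; field; lra.
    have : `|sin u| * u^-1 <= 1 * u^-1 by rewrite ler_pM2r.
    by lra.
  move=> h; have : `|u * K u - C * u + 2| * u <= 4.
    by rewrite -ler_pdivlMr.
  by have := normr_ge0 (u * K u - C * u + 2); have := normr_ge0 C; nra.
have h1 : 0 <= K u by rewrite -K0 Knd.
have h2 : K u <= K 1 by rewrite Knd// ltW.
have : `|u * K u - C * u + 2| <= K 1 + `|C| + 2.
  apply: (le_trans (ler_normD _ _)); rewrite (ger0_norm (_ : 0 <= 2))// lerD2r.
  apply: (le_trans (ler_normB _ _)); rewrite !normrM (ger0_norm u0) (ger0_norm h1).
  by have := normr_ge0 C; nra.
by have := normr_ge0 (u * K u - C * u + 2); have := normr_ge0 C; nra.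
Qed.

(** The triangle [2 C max(0, 1 - |xi|)], kept as a second difference of the absolute value because
    the truncated integrals approach it in that form. *)
Definition tent (C xi : R) := C * (`|xi + 1| + `|xi - 1| - 2 * `|xi|).

Lemma tent_eq0 C xi : 1 <= `|xi| -> tent C xi = 0.
Proof.
rewrite /tent; have [x0|x0] := leP 0 xi => x1.
  by rewrite (ger0_norm x0) in x1; rewrite !ger0_norm; lra.
by rewrite (ltr0_norm x0) in x1; rewrite !ler0_norm; lra.
Qed.

Lemma continuous_tent C : continuous (tent C).
Proof.
move=> x; apply: cvgM; first exact: cvg_cst.
apply: cvgB; last by apply: cvgM; [exact: cvg_cst|exact: norm_continuous].
by apply: cvgD; apply: cvg_norm; [apply: cvgD|apply: cvgB];
  [exact: cvg_id|exact: cvg_cst|exact: cvg_id|exact: cvg_cst].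
Qed.

(* Peetre's inequality. *)
Lemma inv1Dnorm_shift xi x :
  (1 + `|xi - x|)^-1 <= (1 + `|x|) * (1 + `|xi|)^-1.
Proof.
have h0 (y : R) : 0 < 1 + `|y| by have := normr_ge0 y; lra.
rewrite ler_pdivlMr// mulrC ler_pdivrMr//.
have : `|xi| <= `|xi - x| + `|x| by have := ler_normD (xi - x) x; rewrite subrK.
by have := normr_ge0 (xi - x); have := normr_ge0 x; nra.
Qed.

Lemma tent_le C xi : `|tent C xi| <= 8 * `|C| * (1 + `|xi|)^-1.
Proof.
have h0 : 0 < 1 + `|xi| by have := normr_ge0 xi; lra.
rewrite ler_pdivlMr//; have [x1|x1] := leP 1 `|xi|.
  by rewrite tent_eq0// normr0 mul0r mulr_ge0.
have h : `| `|xi + 1| + `|xi - 1| - 2 * `|xi| | <= 4.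
  rewrite ler_norml.
  have := ler_normD xi 1; have := ler_normB xi 1; rewrite normr1.
  have := normr_ge0 (xi + 1); have := normr_ge0 (xi - 1).
  have := normr_ge0 xi; lra.
rewrite /tent normrM -mulrA [8 * _]mulrC ler_wpM2l//.
move: h (normr_ge0 (`|xi + 1| + `|xi - 1| - 2 * `|xi|)) (normr_ge0 xi).
by move: `|_ - 2 * _| => b; nra.
Qed.

(** Insert the expansion of [u * K u] at [u = (xi + 1) N], [(xi - 1) N] and [xi N]: the linear parts
    form the tent, the constants cancel, and Peetre's inequality brings the errors back to [xi]. *)
Lemma fourier_trunc_kern_tent : exists C c : R, 0 <= c /\
  forall (N : nat) xi, (0 < N)%N ->
  `|Rintegral mu `[- N%:R, N%:R]%classic (fun x => 2 * kern x * cos (x * xi))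
    - tent C xi| <= c / N%:R * (1 + `|xi|)^-1.
Proof.
have [K [K0 KN dK] KE] := @fourier_trunc_kern R.
have [C [c Kc]] := kern_primitive_asymptotics K0 KN dK.
have c0 : 0 <= c.
  have := le_trans (normr_ge0 _) (Kc 0); rewrite normr0 addr0 invr1; lra.
exists C, (6 * c); split; first by lra.
move=> N xi N0; have n0 : 1 <= N%:R :> R by rewrite ler1n.
rewrite KE; last by lra.
move: (N%:R) n0 => n n1; have n0 : 0 < n by lra.
have Kx x : `|x * K (x * n) * n - C * `|x| * n + 2| <= c * (1 + `|x|)^-1.
  have := Kc (x * n); rewrite normrM (gtr0_norm n0) => h.
  have -> : x * K (x * n) * n - C * `|x| * n + 2 =
    x * n * K (x * n) - C * (`|x| * n) + 2 by ring.
  apply: (le_trans h); rewrite ler_wpM2l// lef_pV2 ?posrE; have := normr_ge0 x;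
    nra.
have s1 := inv1Dnorm_shift xi 1; have s2 := inv1Dnorm_shift xi (-1).
rewrite normrN normr1 opprK in s1 s2.
have h3 := Kx (xi + 1); have h2 := Kx (xi - 1); have h1 := Kx xi.
rewrite -(ler_pM2r n0) -[X in _ * X <= _](gtr0_norm n0) -normrM.
have -> : 6 * c / n * (1 + `|xi|)^-1 * n = 6 * c * (1 + `|xi|)^-1.
  by field; rewrite ?gt_eqF//; have := normr_ge0 xi; lra.
move: h1 h2 h3; set A1 := xi * K _; set A2 := (xi - 1) * _.
set A3 := (xi + 1) * _; rewrite /tent => h1 h2 h3.
(* The constants cancel as [2 + 2 - 2 * 2]. Each shift by 1 costs a factor 2 in the error and the
   middle term counts twice, hence [6 * c]. *)
have -> : (A3 + A2 - 2 * A1 - C * (`|xi + 1| + `|xi - 1| - 2 * `|xi|)) * n =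
  (A3 * n - C * `|xi + 1| * n + 2) + (A2 * n - C * `|xi - 1| * n + 2)
  - 2 * (A1 * n - C * `|xi| * n + 2) by ring.
apply: (le_trans (ler_normB _ _)); rewrite normrM (ger0_norm (_ : 0 <= 2))//.
have h4 := ler_normD (A3 * n - C * `|xi + 1| * n + 2)
  (A2 * n - C * `|xi - 1| * n + 2).
have := ler_wpM2l c0 s1; have := ler_wpM2l c0 s2.
by lra.
Qed.

End asymptotics.

(** * The complex exponential *)

Section complex_exp.
Context {R : realType}.
Implicit Types z w h : R[i].
Notation normc := (@Normc.normc R).

Lemma normc_ge0 z : 0 <= normc z.
Proof. by case: z => a b; rewrite /= sqrtr_ge0. Qed.

Lemma normc_gt0 z : z != 0 -> 0 < normc z.
Proof.
move=> z0; rewrite lt_neqAle normc_ge0 andbT eq_sym; apply: contra z0 => /eqP.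
by move/Normc.eq0_normc => ->.
Qed.

Lemma normc_leD z w : normc (z + w) <= normc z + normc w.
Proof. exact: le_normcD. Qed.

Lemma normcB z w : normc (z - w) = normc (w - z).
Proof. by rewrite -normcN opprB. Qed.

Lemma normc_Re z : `|complex.Re z| <= normc z.
Proof.
case: z => a b /=; rewrite -sqrtr_sqr ler_wsqrtr// lerDl sqr_ge0//.
Qed.

Lemma normc_Im z : `|complex.Im z| <= normc z.
Proof.
case: z => a b /=; rewrite -sqrtr_sqr ler_wsqrtr// lerDr sqr_ge0//.
Qed.

Lemma normc_real (a : R) : normc (Complex a 0) = `|a|.
Proof. by rewrite /= expr0n addr0 sqrtr_sqr. Qed.

Lemma normc_imag (a : R) : normc (Complex 0 a) = `|a|.
Proof. by rewrite /= expr0n add0r sqrtr_sqr. Qed.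

Lemma normc_le_norm (a b : R) : normc (Complex a b) <= `|a| + `|b|.
Proof.
rewrite -normc_real -normc_imag.
apply: le_trans (normc_leD _ _).
by rewrite le_eqVlt; apply/orP; left; apply/eqP; congr normc; simpc.
Qed.

Lemma normc_sub_norm z w : normc z - normc w <= normc (z - w).
Proof. by rewrite lerBlDr -[in leLHS](subrK w z) normc_leD. Qed.

Lemma normc_sum (I : Type) (r : seq I) (P : pred I) (F : I -> R[i]) :
  normc (\sum_(i <- r | P i) F i) <= \sum_(i <- r | P i) normc (F i).
Proof.
elim/big_rec2 : _ => [|i x y _ h]; first by rewrite Normc.normc0.
by apply: le_trans (normc_leD _ _) _; rewrite lerD2l.
Qed.

Lemma normc_prod (I : Type) (r : seq I) (P : pred I) (F : I -> R[i]) :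
  normc (\prod_(i <- r | P i) F i) = \prod_(i <- r | P i) normc (F i).
Proof.
elim/big_rec2 : _ => [|i x y _ h]; first by rewrite Normc.normc1.
by rewrite Normc.normcM h.
Qed.

Definition cexp z : R[i] :=
  Complex (expR (complex.Re z) * cos (complex.Im z))
          (expR (complex.Re z) * sin (complex.Im z)).

Lemma cexp0 : cexp 0 = 1.
Proof. by rewrite /cexp /= expR0 cos0 sin0 !mul1r. Qed.

Lemma cexpD z w : cexp (z + w) = cexp z * cexp w.
Proof.
case: z => a b; case: w => c d; rewrite /cexp /= expRD cosD sinD; simpc.
by congr Complex; ring.
Qed.

Lemma normc_cexp z : normc (cexp z) = expR (complex.Re z).
Proof.
rewrite /= !exprMn -mulrDr cos2Dsin2 mulr1 sqrtr_sqr ger0_norm//.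
Qed.

Lemma cexp_sum (I : Type) (r : seq I) (P : pred I) (F : I -> R[i]) :
  cexp (\sum_(i <- r | P i) F i) = \prod_(i <- r | P i) cexp (F i).
Proof. by apply: big_morph; [exact: cexpD|exact: cexp0]. Qed.

(** Splitting [exp(x + iy) - 1] as [exp x (exp(iy) - 1) + (exp x - 1)] reduces the estimate to real
    Taylor bounds in [x] and [y]; the next two bounds refine this splitting. *)
Lemma normc_cexpB1 w : normc (cexp w - 1) <= 3 * normc w * expR (normc w).
Proof.
case: w => x y.
have -> : cexp (Complex x y) - 1 = Complex (expR x) 0 * Complex (cos y - 1) (sin y)
   + Complex (expR x - 1) 0.
  by rewrite /cexp /=; simpc; congr Complex; ring.
apply: (le_trans (normc_leD _ _)); rewrite Normc.normcM !normc_real.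
rewrite (ger0_norm (expR_ge0 _)).
have hx := normc_Re (Complex x y); have hy := normc_Im (Complex x y).
move: (normc (Complex x y)) hx hy => r /= hx hy.
have ex : expR x <= expR r by rewrite ler_expR (le_trans (ler_norm x)).
have ex' : expR `|x| <= expR r by rewrite ler_expR.
have h1 := normr_expRB1 x; have h2 := normr_cosB1 y; have h3 := normr_sin_le y.
have h4 := normc_le_norm (cos y - 1) (sin y).
have h5 : `|expR x - 1| <= r * expR r.
  by apply: (le_trans h1); rewrite ler_pM ?expR_ge0.
have h6 : expR x * normc (Complex (cos y - 1) (sin y)) <= expR r * (2 * r).
  by rewrite ler_pM ?expR_ge0 ?normc_ge0//; lra.
by apply: le_trans (lerD h6 h5) _; lra.
Qed.

Lemma normc_cexp_taylor2 w :
  normc (cexp w - 1 - w) <= 4 * normc w ^+ 2 * expR (normc w).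
Proof.
case: w => x y.
have -> : cexp (Complex x y) - 1 - Complex x y =
   Complex (expR x) 0 * Complex (cos y - 1) (sin y - y)
   + (Complex (expR x - 1 - x) 0 + Complex 0 (y * (expR x - 1))).
  by rewrite /cexp /=; simpc; congr Complex; ring.
apply: (le_trans (normc_leD _ _)).
apply: le_trans (lerD (lexx _) (normc_leD _ _)) _.
rewrite Normc.normcM !normc_real normc_imag normrM.
rewrite (ger0_norm (expR_ge0 _)).
have hx := normc_Re (Complex x y); have hy := normc_Im (Complex x y).
move: (normc (Complex x y)) hx hy => r /= hx hy.
have r0 : 0 <= r by exact: le_trans hx.
have ex : expR x <= expR r by rewrite ler_expR (le_trans (ler_norm x)).
have ex' : expR `|x| <= expR r by rewrite ler_expR.
have x2 : x ^+ 2 <= r ^+ 2 by rewrite -(real_normK (num_real x)) ler_sqr ?nnegrE.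
have y2 : y ^+ 2 <= r ^+ 2 by rewrite -(real_normK (num_real y)) ler_sqr ?nnegrE.
have h1 := normr_expRB1 x; have h2 := normr_cosB1_le_sqr y.
have h3 := normr_sinBx_le_sqr y.
have h4 := normc_le_norm (cos y - 1) (sin y - y).
have h5 : `|expR x - 1| <= r * expR r.
  by apply: (le_trans h1); rewrite ler_pM ?expR_ge0.
have h7 : `|expR x - 1 - x| <= r ^+ 2 * expR r.
  by apply: (le_trans (expR_taylor2 x)); rewrite ler_pM ?expR_ge0 ?sqr_ge0.
have h6 : expR x * normc (Complex (cos y - 1) (sin y - y))
    <= expR r * (2 * r ^+ 2).
  by rewrite ler_pM ?expR_ge0 ?normc_ge0//; lra.
have h8 : `|y| * `|expR x - 1| <= r * (r * expR r) by rewrite ler_pM.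
by apply: le_trans (lerD h6 (lerD h7 h8)) _; lra.
Qed.

Lemma normc_cexp_taylor3 w :
  normc (cexp w - 1 - w - w ^+ 2 / 2) <= 6 * normc w ^+ 3 * expR (normc w).
Proof.
case: w => x y.
have -> : cexp (Complex x y) - 1 - Complex x y - Complex x y ^+ 2 / 2 =
   Complex (expR x) 0 * Complex (cos y - 1 + y ^+ 2 / 2) (sin y - y)
   + (Complex (expR x - 1 - x - x ^+ 2 / 2) 0
   + (Complex 0 (y * (expR x - 1 - x)) + Complex (- (y ^+ 2 / 2) * (expR x - 1)) 0)).
  have -> : Complex x y ^+ 2 / 2 = Complex ((x ^+ 2 - y ^+ 2) / 2) (x * y).
    have -> : 2 = Complex 2 0 :> R[i] by rewrite mulr2n; simpc.
    apply: (@mulIf _ (Complex (2 : R) 0)).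
      by rewrite eq_complex /= negb_and pnatr_eq0.
    rewrite divfK; last by rewrite eq_complex /= negb_and pnatr_eq0.
    by rewrite expr2; simpc; congr Complex; field.
  by rewrite /cexp /=; simpc; congr Complex; ring.
apply: (le_trans (normc_leD _ _)).
apply: le_trans (lerD (lexx _) (normc_leD _ _)) _.
apply: le_trans (lerD (lexx _) (lerD (lexx _) (normc_leD _ _))) _.
rewrite Normc.normcM !normc_real normc_imag !normrM normrN.
rewrite (ger0_norm (expR_ge0 _)).
have hx := normc_Re (Complex x y); have hy := normc_Im (Complex x y).
move: (normc (Complex x y)) hx hy => r /= hx hy.
have r0 : 0 <= r by exact: le_trans hx.
have ex : expR x <= expR r by rewrite ler_expR (le_trans (ler_norm x)).
have ex' : expR `|x| <= expR r by rewrite ler_expR.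
have x2 : x ^+ 2 <= r ^+ 2 by rewrite -(real_normK (num_real x)) ler_sqr ?nnegrE.
have y2 : y ^+ 2 <= r ^+ 2 by rewrite -(real_normK (num_real y)) ler_sqr ?nnegrE.
have x3 : `|x| ^+ 3 <= r ^+ 3 by rewrite lerXn2r ?nnegrE.
have y3 : `|y| ^+ 3 <= r ^+ 3 by rewrite lerXn2r ?nnegrE.
have h1 := normr_expRB1 x; have h2 := normr_cos_taylor y.
have h3 := normr_sinBx_le_cube y.
have h4 := normc_le_norm (cos y - 1 + y ^+ 2 / 2) (sin y - y).
have h5 : `|expR x - 1| <= r * expR r.
  by apply: (le_trans h1); rewrite ler_pM ?expR_ge0.
have h7 : `|expR x - 1 - x| <= r ^+ 2 * expR r.
  by apply: (le_trans (expR_taylor2 x)); rewrite ler_pM ?expR_ge0 ?sqr_ge0.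
have h9 : `|expR x - 1 - x - x ^+ 2 / 2| <= r ^+ 3 * expR r.
  by apply: (le_trans (expR_taylor3 x)); rewrite ler_pM ?expR_ge0 ?exprn_ge0.
have h6 : expR x * normc (Complex (cos y - 1 + y ^+ 2 / 2) (sin y - y))
    <= expR r * (2 * r ^+ 3).
  by rewrite ler_pM ?expR_ge0 ?normc_ge0//; lra.
have h8 : `|y| * `|expR x - 1 - x| <= r * (r ^+ 2 * expR r) by rewrite ler_pM.
have h10 : `|y ^+ 2 / 2| * `|expR x - 1| <= r ^+ 2 * (r * expR r).
  rewrite ler_pM// ger0_norm ?divr_ge0 ?sqr_ge0//.
  by have := sqr_ge0 y; lra.
have -> : 6 * r ^+ 3 * expR r = expR r * (2 * r ^+ 3) + (r ^+ 3 * expR r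
  + (r * (r ^+ 2 * expR r) + r ^+ 2 * (r * expR r))) + r ^+ 3 * expR r by ring.
have : 0 <= r ^+ 3 * expR r by rewrite mulr_ge0 ?exprn_ge0 ?expR_ge0.
move=> h.
by apply: le_trans (lerD h6 (lerD h9 (lerD h8 h10))) _; lra.
Qed.

End complex_exp.

(** * Complex differentiability, and the entire extension of phi *)

Section complex_diff.
Context {R : realType}.
Implicit Types z w h : R[i].
Notation normc := (@Normc.normc R).

Lemma normCE z : `|z| = (normc z)%:C%C.
Proof. by rewrite normc_def; case: z. Qed.

(** The difference quotient is within [B * normc h] of [d]. Differentiability thereby reduces to an
    explicit remainder estimate, which can be summed over a series. *)
Lemma derivable_quadratic (f : R[i] -> R[i]) (z d : R[i]) (B e : R) :
  0 < e ->
  (forall h, normc h < e -> normc (f (z + h) - f z - d * h) <= B * normc h ^+ 2) ->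
  derivable (f : R[i]^o -> R[i]^o) z 1.
Proof.
move=> e0 H; apply/cvg_ex; exists d.
apply/cvgrPdist_le => eps eps0.
(* A positive element of [R[i]] has imaginary part 0, so [eps] is the image of a real number. *)
have [r r0 epsE] : exists2 r : R, 0 < r & eps = r%:C%C.
  move: eps0; rewrite ltcE /= => /andP[/eqP im re].
  by exists (complex.Re eps) => //; case: eps im re => a b /= -> _.
(* The radius below divides by this bound, and [B] may be zero or negative. *)
pose B' := Num.max B 1.
have B'0 : 0 < B' by rewrite lt_max ltr01 orbT.
have d0 : 0 < (Num.min e (r / B'))%:C%C :> R[i].
  by rewrite ltcR lt_min e0 divr_gt0.
exists (Num.min e (r / B'))%:C%C => //= h.
rewrite /= sub0r normrN normCE ltcR lt_min => /andP[he hr] h0.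
rewrite epsE normCE lecR.
have nh : 0 < normc h by exact: normc_gt0.
have -> : d - h^-1 *: (f (h *: 1 + z) - f z) =
    - (h^-1 * (f (z + h) - f z - d * h)).
  have -> : h *: 1 + z = z + h by rewrite /GRing.scale /= mulr1 addrC.
  by rewrite /GRing.scale /= [in RHS]mulrBr [d * h]mulrC (mulKf h0) opprB.
rewrite normcN Normc.normcM Normc.normcV mulrC ler_pdivrMr//.
apply: (le_trans (H h he)).
have hB : normc h * B' <= r by rewrite -ler_pdivlMr// ltW.
have BB : B <= B' by rewrite le_max lexx.
apply: (@le_trans _ _ (B' * normc h ^+ 2)); first by rewrite ler_wpM2r ?sqr_ge0.
rewrite expr2 mulrA; apply: ler_wpM2r; first exact: ltW.
by rewrite mulrC.
Qed.

Lemma derivable_cexpM (c z : R[i]) :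
  derivable ((fun z => cexp (c * z)) : R[i]^o -> R[i]^o) z 1.
Proof.
have c0 : 0 <= normc c by exact: normc_ge0.
apply: (@derivable_quadratic _ z (c * cexp (c * z))
  (4 * normc (cexp (c * z)) * normc c ^+ 2 * expR (normc c)) 1) => // h h1.
have -> : cexp (c * (z + h)) - cexp (c * z) - c * cexp (c * z) * h =
  cexp (c * z) * (cexp (c * h) - 1 - c * h).
  by rewrite mulrDr cexpD; ring.
rewrite Normc.normcM.
have h0 := normc_ge0 h; have e0 := normc_ge0 (cexp (c * z)).
apply: le_trans (ler_wpM2l e0 (normc_cexp_taylor2 (c * h))) _.
rewrite Normc.normcM exprMn.
have : expR (normc c * normc h) <= expR (normc c).
  by rewrite ler_expR ler_piMr// ltW.
move=> h2; have {}h2 := ler_wpM2l (_ : 0 <= 4 * normc (cexp (c * z))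
  * normc c ^+ 2 * normc h ^+ 2) h2.
have := h2 _; move=> /(_ _)/wrap[]; first by rewrite !mulr_ge0 ?sqr_ge0.
by lra.
Qed.

Definition cpsi w : R[i] := if w == 0 then 1 else (cexp w - 1) / w.

Lemma cpsiE w : w != 0 -> cpsi w = (cexp w - 1) / w.
Proof. by rewrite /cpsi => /negbTE ->. Qed.

Lemma cpsi0 : cpsi 0 = 1. Proof. by rewrite /cpsi eqxx. Qed.

Lemma normc_cpsi_le w : normc (cpsi w) <= 3 * expR (normc w).
Proof.
have [->|w0] := eqVneq w 0.
  by rewrite cpsi0 Normc.normc1 Normc.normc0 expR0; lra.
have nw : 0 < normc w by exact: normc_gt0.
rewrite cpsiE// Normc.normcM Normc.normcV ler_pdivrMr// mulrAC.
exact: normc_cexpB1.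
Qed.

(** At 0 the third-order remainder of the exponential, divided by [c * h], is quadratic in [h], with
    derivative [c / 2]. Elsewhere the quotient formula holds on a neighbourhood. *)
Lemma derivable_cpsiM (c z : R[i]) : c != 0 ->
  derivable ((fun z => cpsi (c * z)) : R[i]^o -> R[i]^o) z 1.
Proof.
move=> c0; have [->|z0] := eqVneq z 0.
  apply: (@derivable_quadratic _ 0 (c / 2)
    (6 * normc c ^+ 2 * expR (normc c)) 1) => // h h1.
  rewrite add0r mulr0 cpsi0; have [->|h0] := eqVneq h 0.
    by rewrite !mulr0 cpsi0 subrr subr0 Normc.normc0 expr0n mulr0.
  have ch : c * h != 0 by rewrite mulf_neq0.
  have -> : cpsi (c * h) - 1 - c / 2 * h =
    (cexp (c * h) - 1 - c * h - (c * h) ^+ 2 / 2) / (c * h).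
    by rewrite cpsiE//; field; rewrite ?c0 ?h0 ?pnatr_eq0.
  have nw : 0 < normc (c * h) by exact: normc_gt0.
  rewrite Normc.normcM Normc.normcV ler_pdivrMr//.
  apply: (le_trans (normc_cexp_taylor3 _)).
  rewrite Normc.normcM.
  have hc := normc_ge0 c; have hh := normc_ge0 h.
  have : expR (normc c * normc h) <= expR (normc c).
    by rewrite ler_expR ler_piMr// ltW.
  move=> h2; have := ler_wpM2l (_ : 0 <= 6 * (normc c * normc h) ^+ 3) h2.
  move=> /(_ _)/wrap[]; first by rewrite !mulr_ge0 ?exprn_ge0 ?mulr_ge0.
  by lra.
pose E : R[i]^o -> R[i]^o := fun z => cexp (c * z).
pose L : R[i]^o -> R[i]^o := fun z => c * z.
have dE : derivable E z 1 by exact: derivable_cexpM.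
have dE1 : derivable (E - cst 1) z 1.
  by apply: derivableB; [exact: dE|exact: derivable_cst].
have dL : derivable L z 1.
  apply: (@derivable_quadratic _ z c 0 1) => // h _.
  have -> : L (z + h) - L z - c * h = 0 by rewrite /L; ring.
  by rewrite Normc.normc0 mul0r.
have dLV : derivable ((fun z => (L z)^-1) : R[i]^o -> R[i]^o) z 1.
  by apply: derivableV; [rewrite /L mulf_neq0|exact: dL].
have dM := derivableM dE1 dLV.
apply: (@near_eq_derivable R[i] R[i]^o R[i]^o
  ((E - cst 1) * ((fun z => (L z)^-1) : R[i]^o -> R[i]^o))); last exact: dM.
have : \forall y \near (z : R[i]^o), y != 0.
  exists `|z|; first by rewrite /= normr_gt0.
  move=> y /= zy; apply/eqP => y0; move: zy.
  by rewrite y0 subr0 ltxx.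
by apply: filterS => y y0; rewrite cpsiE// mulf_neq0.
Qed.

(** The entire extension of phi: [(exp(iz) - 1)(exp(-iz) - 1) = 2 - 2 cos z] and [(iz)(-iz) = z^2].
    In this factored form the only removable singularity to treat is that of [cpsi]. *)
Definition cphi z : R[i] := cpsi (Complex 0 1 * z) * cpsi (Complex 0 (-1) * z).

Lemma derivable_cphi z : derivable (cphi : R[i]^o -> R[i]^o) z 1.
Proof.
by apply: derivableM; apply: derivable_cpsiM;
  rewrite eq_complex /= eqxx ?oppr_eq0 oner_eq0.
Qed.

Lemma cphi_real (x : R) : cphi (Complex x 0) = Complex (2 * kern x) 0.
Proof.
have [->|x0] := eqVneq x 0.
  rewrite /cphi !mulr0 cpsi0 kern0 mulr1 divff//.
rewrite kernE//; rewrite /cphi; simpc.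
have X0 (s : R) : s != 0 -> Complex 0 s != 0.
  by move=> s0; rewrite eq_complex /= eqxx.
rewrite !cpsiE ?X0 ?oppr_eq0//.
rewrite /cexp /= expR0 !mul1r cosN sinN mulrACA -invfM.
simpc.
congr Complex; last by ring.
have -> : (cos x - 1) * (cos x - 1) + sin x * sin x = 2 * (1 - cos x).
  by have := cos2Dsin2 x; nra.
by field.
Qed.

(** For [|x| <= 1] each factor is at most [3 * expR 2]. For larger [|x|] each numerator is at most
    [2 * expR 1] and each denominator at least [|x|]. The first-order decay retained is enough for
    square integrability. *)
Lemma normc_cphi_le (x y : R) : `|y| < 1 ->
  normc (cphi (Complex x y)) <= 36 * expR 4 * (1 + `|x|)^-1.
Proof.
move=> y1; have h0 : 0 < 1 + `|x| by have := normr_ge0 x; lra.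
rewrite ler_pdivlMr//.
have e0 : 1 <= expR 1 :> R by rewrite -expR0 ler_expR.
have e4 : expR 4 = expR 2 * expR 2 :> R by rewrite -expRD; congr expR; lra.
have e2 : expR 2 = expR 1 * expR 1 :> R by rewrite -expRD; congr expR; lra.
have [x1|x1] := leP `|x| 1.
  have hz : normc (Complex x y) <= 2.
    by apply: (le_trans (normc_le_norm _ _)); lra.
  have b1 (s : R) : `|s| = 1 ->
      normc (cpsi (Complex 0 s * Complex x y)) <= 3 * expR 2.
    move=> s1; apply: (le_trans (normc_cpsi_le _)).
    by rewrite ler_pM2l// ler_expR Normc.normcM normc_imag s1 mul1r.
  rewrite /cphi Normc.normcM e4.
  have := b1 1 (normr1 _); have := b1 (-1) (normrN1 _).
  have := normc_ge0 (cpsi (Complex 0 1 * Complex x y)).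
  have := normc_ge0 (cpsi (Complex 0 (-1) * Complex x y)).
  move: (normc (cpsi _)) (normc (cpsi _)) => p q q0 p0 pq1 pq2.
  have : q * p <= (3 * expR 2) * (3 * expR 2) by rewrite ler_pM.
  have : 0 <= q * p by rewrite mulr_ge0.
  have := normr_ge0 x; nra.
have x0 : x != 0 by rewrite -normr_gt0; lra.
have nx := normc_Re (Complex x y).
have xp : 0 < `|x| by lra.
have b1 (s : R) : `|s| = 1 ->
    normc (cpsi (Complex 0 s * Complex x y)) <= (2 * expR 1) / `|x|.
  move=> s1; rewrite cpsiE; last first.
    rewrite mulf_neq0// eq_complex /= negb_and ?x0// eqxx /=.
    by rewrite -normr_gt0 s1.
  rewrite Normc.normcM Normc.normcV Normc.normcM normc_imag s1 mul1r.
  rewrite ler_pM ?normc_ge0 ?invr_ge0 ?normc_ge0//; last first.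
    by rewrite lef_pV2 ?posrE//; exact: lt_le_trans nx.
  apply: (le_trans (normc_leD _ _)); rewrite normcN Normc.normc1 normc_cexp.
  simpc; rewrite /=.
  have : expR (- (s * y)) <= expR 1 :> R.
    rewrite ler_expR; apply: le_trans (ler_norm _) _.
    by rewrite normrN normrM s1 mul1r ltW.
  by lra.
rewrite /cphi Normc.normcM e4 e2.
have := b1 1 (normr1 _); have := b1 (-1) (normrN1 _).
have := normc_ge0 (cpsi (Complex 0 1 * Complex x y)).
have := normc_ge0 (cpsi (Complex 0 (-1) * Complex x y)).
move: (normc (cpsi _)) (normc (cpsi _)) => p q q0 p0 pq1 pq2.
have : q * p <= (2 * expR 1 / `|x|) * (2 * expR 1 / `|x|) by rewrite ler_pM.
have -> : (2 * expR 1 / `|x|) * (2 * expR 1 / `|x|) =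
  4 * (expR 1 * expR 1) * `|x| ^- 2 by field; lra.
move=> h; have {}h : q * p * (1 + `|x|) <= 8 * (expR 1 * expR 1).
  apply: le_trans (ler_wpM2r (ltW h0) h) _.
  rewrite mulrAC ler_pdivrMr; last by rewrite exprn_gt0//; lra.
  have : 1 + `|x| <= 2 * `|x| ^+ 2 by nra.
  have : 0 < expR 1 * expR 1 :> R by nra.
  nra.
have t1 : 1 <= expR 1 * expR 1 :> R by nra.
by move: (expR 1 * expR 1) h t1 => t h t1; nra.
Qed.

End complex_diff.

(** * The Riesz product *)

(* The terms of the expanded product are indexed by n : nat: the k-th ternary
   digit 0, 1 or 2 of n selects, in the k-th factor, the constant term, the
   frequency lam k or the frequency - lam k. *)
Section digits.
Local Open Scope nat_scope.

Definition digit (n k : nat) : nat := (n %/ 3 ^ k) %% 3.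

Lemma digit0 n : digit n 0 = n %% 3.
Proof. by rewrite /digit expn0 divn1. Qed.

Lemma digitS n k : digit n k.+1 = digit (n %/ 3) k.
Proof. by rewrite /digit expnS divnMA. Qed.

Lemma digit_small n k : n < 3 ^ k -> digit n k = 0.
Proof. by move=> nk; rewrite /digit divn_small. Qed.

Lemma ltn_pow3 n : n < 3 ^ n. Proof. exact: ltn_expl. Qed.

Lemma big_digit_widen (T : Type) (idx : T) (op : Monoid.law idx)
    (F : nat -> nat -> T) (n K L : nat) : (forall k, F k 0 = idx) ->
  n < 3 ^ K -> K <= L ->
  \big[op/idx]_(k < L) F k (digit n k) = \big[op/idx]_(k < K) F k (digit n k).
Proof.
move=> F0 nK KL; rewrite -(subnKC KL) big_split_ord /= [X in op _ X]big1.
  by rewrite Monoid.mulm1.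
move=> i _; rewrite digit_small ?F0//.
by rewrite (leq_trans nK)// leq_pexp2l// leq_addr.
Qed.

(** Digits past the last nonzero one contribute the neutral element. Since [n < 3 ^ n], the index
    [n] itself bounds the number of digits, while proofs may use any common bound [K]. *)
Lemma big_digit (T : Type) (idx : T) (op : Monoid.law idx)
    (F : nat -> nat -> T) (n K : nat) : (forall k, F k 0 = idx) ->
  n < 3 ^ K ->
  \big[op/idx]_(k < n) F k (digit n k) = \big[op/idx]_(k < K) F k (digit n k).
Proof.
move=> F0 nK; have [Kn|nK'] := leqP K n.
  exact: big_digit_widen.
by rewrite (big_digit_widen op F0 (ltn_pow3 n) (ltnW nK')).
Qed.

(** Distributivity: writing [n = 3 m + d] peels off the lowest digit, which chooses the summand of
    the first factor. *)
Lemma sum_prod_digit (T : comPzSemiRingType) (F : nat -> nat -> T) K :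
  (\sum_(0 <= n < 3 ^ K) \prod_(k < K) F k (digit n k) =
   \prod_(k < K) (F k 0%N + F k 1%N + F k 2%N))%R.
Proof.
elim: K F => [|K IH] F.
  by rewrite big_nat1 !big_ord0.
rewrite big_ord_recl -(IH (fun k => F k.+1)) expnSr big_nat_mul big_distrr /=.
apply: eq_bigr => m _.
have E d : (d < 3)%N -> (\prod_(k < K.+1) F k (digit (m * 3 + d) k) =
   F 0%N d * \prod_(k < K) F k.+1 (digit m k))%R.
  move=> d3; rewrite big_ord_recl /= digit0 modnMDl modn_small//; congr (_ * _)%R.
  by apply: eq_bigr => k _; rewrite /= digitS divnMDl// divn_small// addn0.
rewrite mulSn; rewrite (_ : 3 + m * 3 = (m * 3).+3)//.
rewrite !big_nat_recl// ?leqW//.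
have E0 := E 0 isT; have E1 := E 1 isT; have E2 := E 2 isT.
rewrite addn0 in E0; rewrite addn1 in E1; rewrite addn2 in E2.
by rewrite big_geq// addr0 E0 E1 E2 !mulrDl addrA.
Qed.

Definition omega (d : nat) : int := nth 0%R [:: 0%R; 1%R; (-1)%R] d.

(** Modulo 4 the values 0, 1 and -1 are distinct, so the lowest digit is determined; then divide by
    4 and induct. *)
Lemma sum_digit_inj K (n m : nat) : n < 3 ^ K -> m < 3 ^ K ->
  (\sum_(k < K) omega (digit n k) * 4%:Z ^+ k =
   \sum_(k < K) omega (digit m k) * 4%:Z ^+ k)%R -> n = m.
Proof.
elim: K n m => [|K IH] n m; first by rewrite expn0 !ltnS !leqn0 => /eqP-> /eqP->.
move=> nK mK; rewrite !big_ord_recl /= !digit0 !expr0 !mulr1.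
have E p : (\sum_(i < K) omega (digit p (bump 0 i)) * 4%:Z ^+ bump 0 i =
   4 * \sum_(i < K) omega (digit (p %/ 3) i) * 4%:Z ^+ i)%R.
  rewrite mulr_sumr; apply: eq_bigr => i _.
  by rewrite /bump leq0n add1n digitS exprS; ring.
rewrite !E; move: (IH (n %/ 3) (m %/ 3)).
rewrite !ltn_divLR// -!expnSr => /(_ nK mK).
have := ltn_pmod n (isT : 0 < 3); have := ltn_pmod m (isT : 0 < 3).
move=> mm nn H eq.
have {}eq : (omega (n %% 3) = omega (m %% 3) /\
  \sum_(i < K) omega (digit (n %/ 3) i) * 4%:Z ^+ i =
  \sum_(i < K) omega (digit (m %/ 3) i) * 4%:Z ^+ i)%R.
  move: eq mm nn; case: (n %% 3) => [|[|[|]]]//; case: (m %% 3) => [|[|[|]]]//;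
    rewrite /omega /=; lia.
case: eq => eq1 /H eq2.
rewrite (divn_eq n 3) (divn_eq m 3) eq2; congr (_ + _).
by move: eq1 mm nn; case: (n %% 3) => [|[|[|]]]//; case: (m %% 3) => [|[|[|]]].
Qed.

End digits.

(** * Frequencies and coefficients of the expanded product, and their weighted summability *)

Section coefficients.
Context {R : realType}.
Implicit Types (e : nat -> bool) (n k K : nat) (x : R).
Notation normc := (@Normc.normc R).

Definition lam k : R := 4 ^+ k.+1.
Definition amp k : R := expR (- (4 * lam k)) / 2 ^+ k.+1.
Definition sg (b : bool) : R := if b then 1 else - 1.
Definition om (d : nat) : R := (omega d)%:~R.

(** Read off from [1 + i s a sin t = 1 + (s a / 2) exp(it) - (s a / 2) exp(-it)]; the factor [i]
    makes all coefficients real. *)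
Definition wt e k d : R :=
  if d == 0%N then 1 else om d * sg (e k) * (amp k / 2).
Definition wabs k d : R := if d == 0%N then 1 else amp k / 2.

Definition freq n : R := \sum_(k < n) om (digit n k) * lam k.
Definition coef e n : R := \prod_(k < n) wt e k (digit n k).
Definition mag n : R := \prod_(k < n) wabs k (digit n k).

Lemma lam_gt0 k : 0 < lam k. Proof. by rewrite exprn_gt0. Qed.

Lemma amp_gt0 k : 0 < amp k.
Proof. by rewrite divr_gt0 ?expR_gt0 ?exprn_gt0. Qed.

Lemma digit_cases n k : [\/ digit n k = 0, digit n k = 1 | digit n k = 2]%N.
Proof.
have : (digit n k < 3)%N by rewrite ltn_pmod.
by case: (digit n k) => [|[|[|]]]// _; [constructor 1|constructor 2|constructor 3].
Qed.

Lemma om0 : om 0 = 0. Proof. by []. Qed.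
Lemma om1 : om 1 = 1. Proof. by []. Qed.
Lemma om2 : om 2 = -1. Proof. by []. Qed.

Lemma normr_coef e n : `|coef e n| = mag n.
Proof.
rewrite /coef normr_prod; apply: eq_bigr => k _.
rewrite /wt /wabs; have a0 : 0 <= amp k / 2 by rewrite divr_ge0 ?ltW ?amp_gt0.
have s1 : `|sg (e k)| = 1 by rewrite /sg; case: (e k); rewrite ?normrN1 ?normr1.
by case: (digit_cases n k) => -> /=; rewrite ?normr1// -mulrA normrM normrM s1
  mul1r (ger0_norm a0) ?om1 ?om2 ?normrN1 ?normr1 mul1r.
Qed.

Lemma mag_ge0 n : 0 <= mag n.
Proof. by rewrite -(normr_coef (fun=> true)). Qed.

Lemma freq_widen n K : (n < 3 ^ K)%N ->
  freq n = \sum_(k < K) om (digit n k) * lam k.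
Proof.
move=> nK; apply: (@big_digit _ 0 +%R (fun k d => om d * lam k)) => // k.
by rewrite om0 mul0r.
Qed.

Lemma coef_widen e n K : (n < 3 ^ K)%N ->
  coef e n = \prod_(k < K) wt e k (digit n k).
Proof. by move=> nK; apply: (@big_digit _ 1 *%R (wt e)). Qed.

Lemma mag_widen n K : (n < 3 ^ K)%N ->
  mag n = \prod_(k < K) wabs k (digit n k).
Proof. by move=> nK; apply: (@big_digit _ 1 *%R wabs). Qed.

Lemma freq_int n K : (n < 3 ^ K)%N ->
  freq n = 4 * (\sum_(k < K) omega (digit n k) * 4%:Z ^+ k)%:~R.
Proof.
move=> nK; rewrite (freq_widen nK) rmorph_sum mulr_sumr; apply: eq_bigr => k _.
by rewrite rmorphM rmorphXn /= /lam exprS /om; ring.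
Qed.

(** Frequencies are 4 times integers, and distinct indices give distinct integers. A gap above 2
    separates the supports of translated tents. *)
Lemma freq_separated n m : n != m -> 4 <= `|freq n - freq m|.
Proof.
move=> nm; pose K := maxn n m.
have nK : (n < 3 ^ K)%N.
  by rewrite (leq_trans (ltn_pow3 n))// leq_pexp2l// leq_maxl.
have mK : (m < 3 ^ K)%N.
  by rewrite (leq_trans (ltn_pow3 m))// leq_pexp2l// leq_maxr.
rewrite (freq_int nK) (freq_int mK) -mulrBr normrM ger0_norm// -intrB.
rewrite ler_peMr// -intr_norm -[1]/(1%:~R) ler_int -gtz0_ge1 normr_gt0 subr_eq0.
by apply: contra nm => /eqP /(sum_digit_inj nK mK) ->.
Qed.

Lemma prod_halves_le K : \prod_(k < K) (1 + (2 ^+ k.+1)^-1) <= expR 1 :> R.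
Proof.
(* The sharper bound is the one that passes through the induction. *)
apply: (@le_trans _ _ (expR (1 - (2 ^+ K)^-1))); last first.
  by rewrite ler_expR lerBlDr lerDl invr_ge0 exprn_ge0.
elim: K => [|K IH]; first by rewrite big_ord0 expr0 invr1 subrr expR0.
rewrite big_ord_recr /=.
have -> : 1 - (2 ^+ K.+1)^-1 = 1 - (2 ^+ K)^-1 + (2 ^+ K.+1)^-1 :> R.
  by rewrite exprS; field; rewrite expf_neq0.
rewrite expRD; apply: ler_pM => //; last exact: expR_ge1Dx.
by rewrite prodr_ge0// => k _; rewrite addr_ge0 ?invr_ge0 ?exprn_ge0.
Qed.

(** The weight is bounded by a product over digits, so the sum is at most the product of the
    [1 + amp k * expR (4 * lam k)], and [amp] is chosen to make this factor [1 + 2^-(k+1)]. All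
    convergence on the strip and all decay of the transforms come from this estimate. *)
Lemma mag_sum K : \sum_(0 <= n < K) mag n * expR (4 * `|freq n|) <= expR 1.
Proof.
apply: le_trans _ (prod_halves_le K).
pose W k d : R := if d == 0%N then 1 else amp k / 2 * expR (4 * lam k).
have W0 k d : 0 <= W k d.
  by rewrite /W; case: ifP => // _; rewrite !mulr_ge0 ?expR_ge0 ?ltW ?amp_gt0.
have -> : \prod_(k < K) (1 + (2 ^+ k.+1)^-1) =
    \prod_(k < K) (W k 0%N + W k 1%N + W k 2%N) :> R.
  apply: eq_bigr => k _; rewrite /W /= /amp expRN.
  by field; rewrite ?expf_neq0 ?expR_eq0.
have K3 : (K <= 3 ^ K)%N by exact/ltnW/ltn_pow3.
(* The range is enlarged from [K] to [3 ^ K] terms, where the sum factors. *)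
rewrite -sum_prod_digit [leRHS](big_cat_nat (n := K))//=.
rewrite -[leLHS]addr0; apply: lerD; last first.
  by apply: sumr_ge0 => n _; apply: prodr_ge0.
apply: ler_sum_nat => n /andP[_ nK].
have {}nK : (n < 3 ^ K)%N by exact: leq_trans (ltnW (ltn_pow3 K)).
rewrite (mag_widen nK) (freq_widen nK).
apply: (@le_trans _ _ (\prod_(k < K) wabs k (digit n k) *
   expR (\sum_(k < K) (4 * (`|om (digit n k)| * lam k))))).
  apply: ler_wpM2l; first by rewrite -(mag_widen nK) mag_ge0.
  rewrite ler_expR -mulr_sumr ler_pM2l//; apply: (le_trans (ler_norm_sum _ _ _)).
  by apply: ler_sum => k _; rewrite normrM (gtr0_norm (lam_gt0 k)).
rewrite expR_sum -big_split /=; apply: ler_prod => k _.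
rewrite /W /wabs; case: (digit_cases n k) => -> /=;
  rewrite ?om0 ?om1 ?om2 ?normrN1 ?normr1 ?normr0 ?mul0r ?mulr0 ?expR0 ?mul1r
    ?mulr1 ?lexx ?ler01 ?andbT//.
- by rewrite !mulr_ge0 ?expR_ge0 ?ltW ?amp_gt0.
- by rewrite !mulr_ge0 ?expR_ge0 ?ltW ?amp_gt0.
Qed.

Definition term e n (z : R[i]) : R[i] :=
  Complex (coef e n) 0 * cexp (Complex 0 (freq n) * z).

Lemma normc_term e n (x y : R) :
  normc (term e n (Complex x y)) = mag n * expR (- (freq n * y)).
Proof.
rewrite /term Normc.normcM normc_real normr_coef normc_cexp; congr (_ * expR _).
by simpc.
Qed.

(** The first [3 ^ K] indices are those with at most [K] digits, so this partial sum is exactly the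
    expansion of [K] factors. Later arguments pass to the limit along these lengths. *)
Lemma sum_term e K x : \sum_(0 <= n < 3 ^ K) term e n (Complex x 0) =
  \prod_(k < K) Complex 1 (sg (e k) * amp k * sin (lam k * x)).
Proof.
pose F k d : R[i] := Complex (wt e k d) 0 * cexp (Complex 0 (om d * lam k * x)).
have -> : \prod_(k < K) Complex 1 (sg (e k) * amp k * sin (lam k * x)) =
    \prod_(k < K) (F k 0%N + F k 1%N + F k 2%N).
  apply: eq_bigr => k _; rewrite /F /wt /= om0 om1 om2 /cexp /=.
  rewrite (_ : -1 * lam k * x = - (lam k * x)); last by ring.
  rewrite !mul0r expR0 cos0 sin0 !mul1r cosN sinN; simpc.
  by congr Complex; field.
rewrite -sum_prod_digit; apply: eq_big_nat => n /andP[_ nK].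
rewrite /term (coef_widen e nK) (freq_widen nK) /F big_split /=; congr (_ * _).
  by rewrite -[LHS]/(real_complex R _) rmorph_prod.
rewrite -cexp_sum; congr cexp; simpc.
rewrite mulr_suml.
by elim/big_rec2 : _ => // k a b _ <-; simpc.
Qed.

End coefficients.

(** * Series of complex numbers and their termwise differentiation *)

Section complex_series.
Context {R : realType}.
Notation normc := (@Normc.normc R).
Implicit Types (u v : nat -> R[i]) (s t : R[i]).

(** Convergence is stated with the real-valued modulus, so that real estimates apply directly. *)
Definition csums u s := forall e : R, 0 < e ->
  exists K0 : nat, forall K, (K0 <= K)%N ->
    normc (s - \sum_(0 <= n < K) u n) <= e.

Lemma csums_le u s (M : R) : csums u s ->
  (forall K, \sum_(0 <= n < K) normc (u n) <= M) -> normc s <= M.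
Proof.
move=> us uM; apply/ler_addgt0Pr => e e0; have [K /(_ K (leqnn K))] := us e e0.
have := normc_sub_norm s (\sum_(0 <= n < K) u n).
have := normc_sum (index_iota 0 K) xpredT u; have := uM K; lra.
Qed.

Lemma csumsB u v s t : csums u s -> csums v t -> csums (fun n => u n - v n) (s - t).
Proof.
move=> us vt e e0; have e2 : 0 < e / 2 by lra.
have [K1 H1] := us _ e2; have [K2 H2] := vt _ e2.
exists (maxn K1 K2) => K; rewrite geq_max => /andP[/H1 h1 /H2 h2].
rewrite big_split /= sumrN.
have -> : s - t - (\sum_(0 <= n < K) u n - \sum_(0 <= n < K) v n) =
  (s - \sum_(0 <= n < K) u n) + - (t - \sum_(0 <= n < K) v n) by ring.
by apply: (le_trans (normc_leD _ _)); rewrite normcN; lra.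
Qed.

Lemma csumsMl u s c : csums u s -> csums (fun n => c * u n) (c * s).
Proof.
move=> us e e0; have nc := normc_ge0 c.
have e2 : 0 < e / (normc c + 1) by rewrite divr_gt0//; lra.
have [K0 H] := us _ e2; exists K0 => K /H.
rewrite -mulr_sumr -mulrBr Normc.normcM ler_pdivlMr; last by lra.
by have := normc_ge0 (s - \sum_(0 <= n < K) u n); nra.
Qed.

Lemma csumsMr u s c : csums u s -> csums (fun n => u n * c) (s * c).
Proof.
move=> /(csumsMl c); rewrite mulrC.
by under [in X in X -> _]eq_fun do rewrite mulrC.
Qed.

(** The limit is identified along a subsequence: for the Riesz product only the partial sums of
    length [3 ^ K] have a closed form. *)
Lemma csums_unique u s t (q : nat -> nat) : csums u s ->
  (forall K, (K <= q K)%N) ->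
  (exists K0, forall K, (K0 <= K)%N -> \sum_(0 <= n < q K) u n = t) -> s = t.
Proof.
move=> us qK [K1 H1]; apply/eqP; rewrite -subr_eq0; apply/eqP.
apply: Normc.eq0_normc; apply/eqP; rewrite eq_le normc_ge0 andbT.
apply/ler_addgt0Pr => e e0; rewrite add0r; have [K0 H0] := us e e0.
have := H0 (q (maxn K0 K1)); rewrite H1 ?leq_maxr//; apply.
exact: leq_trans (leq_maxl K0 K1) (qK _).
Qed.

Lemma csums_normc_eq u v s t (q : nat -> nat) : csums u s -> csums v t ->
  (forall K, (K <= q K)%N) ->
  (forall K, normc (\sum_(0 <= n < q K) u n) = normc (\sum_(0 <= n < q K) v n)) ->
  normc s = normc t.
Proof.
move=> us vt qK uv.
wlog suff H : u v s t us vt uv / normc s <= normc t.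
  by apply/eqP; rewrite eq_le; apply/andP; split; [exact: (H u v)|exact: (H v u)].
apply/ler_addgt0Pr => e e0; have e2 : 0 < e / 2 by lra.
have [K1 H1] := us _ e2; have [K2 H2] := vt _ e2.
have k1 : (K1 <= q (maxn K1 K2))%N by exact: leq_trans (leq_maxl _ _) (qK _).
have k2 : (K2 <= q (maxn K1 K2))%N by exact: leq_trans (leq_maxr _ _) (qK _).
have := H1 _ k1; have := H2 _ k2; have := uv (maxn K1 K2).
set S := \sum_(_ <= _ < _) u _; set T := \sum_(_ <= _ < _) v _ => ST h2 h1.
have := normc_sub_norm s S; have := normc_sub_norm T t.
rewrite normcB; lra.
Qed.

Lemma cvgn_series_le (a : nat -> R) (b : nat -> R) (M : R) :
  (forall n, `|a n| <= b n) -> (forall K, \sum_(0 <= n < K) b n <= M) ->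
  cvgn (fun K => \sum_(0 <= n < K) a n : R).
Proof.
move=> ab bM; apply: (@normed_cvg R R^o a).
apply: nondecreasing_is_cvgn.
  by apply: nondecreasing_series => n _ _; rewrite normr_ge0.
exists M => _ [K _ <-]; apply: le_trans (bM K).
by apply: ler_sum => n _; exact: ab.
Qed.

Lemma cvgn_eps (a : nat -> R) (l e : R) : a @ \oo --> l -> 0 < e ->
  exists K0 : nat, forall K, (K0 <= K)%N -> `|l - a K| <= e.
Proof.
by move=> /cvgrPdist_le H e0; have [K0 _ HK] := H e e0; exists K0 => K /HK.
Qed.

Lemma complex_sumE (K : nat) u : \sum_(0 <= n < K) u n =
  Complex (\sum_(0 <= n < K) complex.Re (u n)) (\sum_(0 <= n < K) complex.Im (u n)).
Proof. by elim/big_rec3 : _ => // n x y z _ ->; case: (u n) => p q; simpc. Qed.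

Lemma csums_exists u (M : R) :
  (forall K, \sum_(0 <= n < K) normc (u n) <= M) -> exists s, csums u s.
Proof.
move=> uM.
have cr := cvgn_series_le (fun n => normc_Re (u n)) uM.
have ci := cvgn_series_le (fun n => normc_Im (u n)) uM.
have /cvg_ex[a /= ca] := cr; have /cvg_ex[b /= cb] := ci.
exists (Complex a b) => e e0; have e2 : 0 < e / 2 by lra.
have [K1 H1] := cvgn_eps ca e2; have [K2 H2] := cvgn_eps cb e2.
exists (maxn K1 K2) => K; rewrite geq_max => /andP[/H1 h1 /H2 h2].
have -> : Complex a b - \sum_(0 <= n < K) u n =
  Complex (a - \sum_(0 <= n < K) complex.Re (u n))
          (b - \sum_(0 <= n < K) complex.Im (u n)).
  by rewrite complex_sumE; simpc.
apply: (le_trans (normc_le_norm _ _)); lra.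
Qed.

Lemma csums_cvg_Re u s : csums u s ->
  \sum_(0 <= n < K) complex.Re (u n) @[K --> \oo] --> complex.Re s.
Proof.
move=> us; apply/cvgrPdist_le => e e0; have [K0 H] := us e e0.
exists K0 => // K /H; apply: le_trans.
by apply: le_trans (normc_Re _); rewrite complex_sumE; case: (s).
Qed.

Lemma csums_cvg_Im u s : csums u s ->
  \sum_(0 <= n < K) complex.Im (u n) @[K --> \oo] --> complex.Im s.
Proof.
move=> us; apply/cvgrPdist_le => e e0; have [K0 H] := us e e0.
exists K0 => // K /H; apply: le_trans.
by apply: le_trans (normc_Im _); rewrite complex_sumE; case: (s).
Qed.

(** The termwise remainders are quadratic in [h] with summable constants, so the remainder of the
    sum is at most [M * normc h ^+ 2]. *)
Lemma derivable_csums (u : R[i] -> nat -> R[i]) (p : R[i] -> R[i])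
    (u' : nat -> R[i]) (z : R[i]) (b : nat -> R) (M e : R) : 0 < e ->
  (forall h, normc h < e -> csums (u (z + h)) (p (z + h))) ->
  (forall n h, normc h < e ->
    normc (u (z + h) n - u z n - u' n * h) <= b n * normc h ^+ 2) ->
  (forall n, normc (u' n) <= b n) ->
  (forall K, \sum_(0 <= n < K) b n <= M) ->
  derivable (p : R[i]^o -> R[i]^o) z 1.
Proof.
move=> e0 up ub u'b bM.
have [d u'd] : exists d, csums u' d.
  apply: (@csums_exists _ M) => K; apply: le_trans (bM K).
  by apply: ler_sum => n _.
apply: (@derivable_quadratic R p z d M e e0) => h he.
have z0 : csums (u z) (p z).
  by have := up 0; rewrite addr0 Normc.normc0; apply.
have := csumsB (csumsB (up h he) z0) (csumsMr h u'd).
move=> /csums_le; apply => K.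
apply: (@le_trans _ _ (\sum_(0 <= n < K) b n * normc h ^+ 2)).
  by apply: ler_sum => n _; exact: ub.
by rewrite -mulr_suml ler_wpM2r ?sqr_ge0.
Qed.

End complex_series.

(** * Termwise integration of series of functions *)

Section real_series.
Context {R : realType}.
Notation mu := (@lebesgue_measure R).

Lemma cvgn_dist_le (a b : nat -> R) (l m B : R) : a @ \oo --> l ->
  b @ \oo --> m -> (forall K, `|a K - b K| <= B) -> `|l - m| <= B.
Proof.
move=> al bm ab; apply/ler_addgt0Pr => e e0; have e2 : 0 < e / 2 by lra.
have [K1 H1] := cvgn_eps al e2; have [K2 H2] := cvgn_eps bm e2.
have := H1 _ (leq_maxl K1 K2); have := H2 _ (leq_maxr K1 K2).
have := ab (maxn K1 K2); move: (a _) (b _) => x y h1 h2 h3.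
have -> : l - m = (l - x) + (x - y) - (m - y) by ring.
apply: (le_trans (ler_normB _ _)).
have := ler_normD (l - x) (x - y); lra.
Qed.

Lemma continuous_sum_scale (c : nat -> R) (f : nat -> R -> R) K :
  (forall n, continuous (f n)) ->
  continuous (fun x => \sum_(0 <= n < K) c n * f n x).
Proof.
move=> cf; elim: K => [|K IH] x.
  rewrite (_ : (fun _ => _) = fun=> 0); first exact: cvg_cst.
  by apply/funext => y; rewrite big_geq.
rewrite (_ : (fun _ => _) = fun x => \sum_(0 <= n < K) c n * f n x + c K * f K x).
  by apply: cvgD; [exact: IH|apply: cvgM; [exact: cvg_cst|exact: cf]].
by apply/funext => y; rewrite big_nat_recr.
Qed.

Lemma integrable_itv (f : R -> R) (a b : R) : continuous f ->
  mu.-integrable `[a, b]%classic (EFin \o f).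
Proof.
move=> cf; apply: continuous_compact_integrable.
  exact: segment_compact.
exact: continuous_subspaceT.
Qed.

Lemma Rintegral_sum_scale (c : nat -> R) (f : nat -> R -> R) K (a b : R) :
  (forall n, continuous (f n)) ->
  Rintegral mu `[a, b]%classic (fun x => \sum_(0 <= n < K) c n * f n x) =
  \sum_(0 <= n < K) c n * Rintegral mu `[a, b]%classic (f n).
Proof.
move=> cf; elim: K => [|K IH].
  rewrite big_geq// (_ : (fun _ => _) = fun=> 0); last first.
    by apply/funext => y; rewrite big_geq.
  by rewrite Rintegral_cst// mul0r.
rewrite big_nat_recr//= -IH -RintegralZl//; last exact: integrable_itv.
rewrite -RintegralD//.
- by apply: eq_Rintegral => x _; rewrite big_nat_recr.
- by apply: integrable_itv; exact: continuous_sum_scale.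
- apply: (@integrable_itv (fun x => c K * f K x)) => x.
  by apply: cvgM; [exact: cvg_cst|exact: cf].
Qed.

(** Dominated convergence on the segment, with the constant [M * B] as dominating function; [F] is
    measurable as a limit of continuous partial sums. *)
Lemma Rintegral_series (c : nat -> R) (f : nat -> R -> R) (F : R -> R)
    (a b B M : R) : (forall n, continuous (f n)) ->
  (forall n x, `|f n x| <= B) -> (forall K, \sum_(0 <= n < K) `|c n| <= M) ->
  (forall x, \sum_(0 <= n < K) c n * f n x @[K --> \oo] --> F x) ->
  \sum_(0 <= n < K) c n * Rintegral mu `[a, b]%classic (f n) @[K --> \oo]
    --> Rintegral mu `[a, b]%classic F.
Proof.
move=> cf fB cM fF.
have B0 : 0 <= B by exact: le_trans (normr_ge0 _) (fB 0%N 0).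
pose S K x := \sum_(0 <= n < K) c n * f n x.
have mS K : measurable_fun `[a, b]%classic (EFin \o S K).
  by have /integrableP[] := integrable_itv a b (continuous_sum_scale (c := c) (K := K) cf).
have SF x : `[a, b]%classic x -> (EFin \o S ^~ x) @ \oo --> (F x)%:E.
  by move=> _; apply: cvg_EFin; [exact: nearW|exact: fF].
have SB K x : `[a, b]%classic x -> (`|(EFin \o S K) x| <= (M * B)%:E)%E.
  move=> _; rewrite lee_fin (le_trans (ler_norm_sum _ _ _))//.
  apply: (@le_trans _ _ (\sum_(0 <= n < K) `|c n| * B)).
    by apply: ler_sum => n _; rewrite normrM ler_wpM2l.
  by rewrite -mulr_suml ler_wpM2r.
have iMB : mu.-integrable `[a, b]%classic (EFin \o (fun=> M * B)).
  by apply: integrable_itv => x; exact: cvg_cst.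
have mF : measurable_fun `[a, b]%classic (EFin \o F).
  exact: (emeasurable_fun_cvg _ _ mS SF).
have [iF _ H] : [/\ mu.-integrable `[a, b]%classic (EFin \o F),
    (fun K => \int[mu]_(x in `[a, b]) `|(EFin \o S K) x - (EFin \o F) x|)%E
      @ \oo --> 0%E &
    (fun K => \int[mu]_(x in `[a, b]) (EFin \o S K) x)%E @ \oo -->
      (\int[mu]_(x in `[a, b]) (EFin \o F) x)%E].
  apply: (@dominated_convergence _ _ R mu _ _ _ _ (EFin \o (fun=> M * B))) => //.
    exact: aeW.
  by apply: aeW => x K; exact: SB.
have {}H : (\int[mu]_(x in `[a, b]) (S n x)%:E)%E @[n --> \oo] -->
   (Rintegral mu `[a, b]%classic F)%:E.
  rewrite /Rintegral fineK; first by apply: H.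
  by apply: integrable_fin_num => //; exact: iF.
under eq_fun do rewrite -Rintegral_sum_scale//.
exact: fine_cvg H.
Qed.

End real_series.

(** * The Riesz product on the strip, and the uncountable family of functions built from it *)

Section riesz_product.
Context {R : realType}.
Notation mu := (@lebesgue_measure R).
Notation normc := (@Normc.normc R).
Notation mag := (@mag R).
Notation freq := (@freq R).
Implicit Types (e : nat -> bool) (n k K : nat) (x y xi : R) (z h : R[i]).

Lemma mag_sum_le (w : nat -> R) K : (forall n, w n <= expR (4 * `|freq n|)) ->
  \sum_(0 <= n < K) mag n * w n <= expR 1.
Proof.
move=> w4; apply: le_trans (@mag_sum R K).
by apply: ler_sum => n _; rewrite ler_wpM2l ?mag_ge0.
Qed.

Lemma normc_term_le e n z (r : R) : `|complex.Im z| <= r ->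
  normc (term e n z) <= mag n * expR (r * `|freq n|).
Proof.
case: z => x y yr; rewrite /= in yr; rewrite normc_term ler_wpM2l ?mag_ge0// ler_expR.
apply: le_trans (ler_norm _) _; rewrite normrN normrM mulrC.
by rewrite ler_wpM2r.
Qed.

Lemma normc_term_sum e z K : `|complex.Im z| <= 4 ->
  \sum_(0 <= n < K) normc (term e n z) <= expR 1.
Proof.
move=> z4; apply: le_trans (@mag_sum R K).
by apply: ler_sum => n _; exact: normc_term_le.
Qed.

(* Junk value 0 where the series diverges; it converges for |Im z| <= 4. *)
Definition riesz e z : R[i] := xget 0 [set s | csums (fun n => term e n z) s].

Lemma rieszP e z : `|complex.Im z| <= 4 -> csums (fun n => term e n z) (riesz e z).
Proof.
move=> z4; apply: (@xgetPex _ 0 [set s | csums (fun n => term e n z) s]).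
apply: (@csums_exists _ _ (expR 1)) => K; exact: normc_term_sum.
Qed.

Lemma normc_riesz_le e z : `|complex.Im z| <= 4 -> normc (riesz e z) <= expR 1.
Proof.
by move=> z4; apply: csums_le (rieszP e z4) _ => K; exact: normc_term_sum.
Qed.

(** On the strip a term costs [expR |freq n|]; its quadratic remainder adds a squared frequency and
    another exponential, each at most a constant times [expR |freq n|]. The total exponent 3 stays
    below the 4 of [mag_sum]. *)
Lemma derivable_riesz e z : `|complex.Im z| < 1 ->
  derivable (riesz e : R[i]^o -> R[i]^o) z 1.
Proof.
move=> z1.
have f0 n := normr_ge0 (freq n).
have E0 (x : R) : 0 <= x -> 1 <= expR x by move=> x0; rewrite -expR0 ler_expR.
apply: (@derivable_csums R (fun z n => term e n z) (riesz e)
  (fun n => Complex 0 (freq n) * term e n z) z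
  (fun n => 8 * (mag n * expR (4 * `|freq n|))) (8 * expR 1) 1) => //.
- move=> h h1; apply: rieszP.
  have := le_lt_trans (normc_Im h) h1; case: z z1 => a b /= b1.
  case: h h1 => c d h1 /= hd.
  by apply: le_trans (ler_normD _ _) _; lra.
- move=> n h h1.
  have -> : term e n (z + h) - term e n z - Complex 0 (freq n) * term e n z * h =
    term e n z * (cexp (Complex 0 (freq n) * h) - 1 - Complex 0 (freq n) * h).
    by rewrite /term mulrDr cexpD; ring.
  rewrite Normc.normcM.
  have t1 := normc_term_le e n (ltW z1).
  have t2 := normc_cexp_taylor2 (Complex 0 (freq n) * h).
  rewrite Normc.normcM normc_imag in t2.
  have h0 := normc_ge0 h.
  have t3 : expR (`|freq n| * normc h) <= expR `|freq n|.
    by rewrite ler_expR ler_piMr// ltW.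
  have t4 : `|freq n| ^+ 2 <= 2 * expR `|freq n|.
    have := @expR_ge1Dxn R `|freq n| 1 (f0 n).
    rewrite (_ : 2`!%:R = 2)//; lra.
  have t5 : normc (cexp (Complex 0 (freq n) * h) - 1 - Complex 0 (freq n) * h) <=
      8 * normc h ^+ 2 * expR (2 * `|freq n|).
    apply: (le_trans t2); rewrite exprMn.
    rewrite [2 * `|_|]mulr_natl mulr2n expRD.
    apply: (@le_trans _ _ (4 * (2 * expR `|freq n| * normc h ^+ 2) * expR `|freq n|)).
      rewrite ler_pM ?expR_ge0// ?mulr_ge0 ?sqr_ge0//.
      by rewrite ler_pM2l// ler_wpM2r ?sqr_ge0.
    by rewrite le_eqVlt; apply/orP; left; apply/eqP; ring.
  apply: le_trans (ler_pM (normc_ge0 _) (normc_ge0 _) t1 t5) _.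
  rewrite mul1r.
  have -> : mag n * expR `|freq n| * (8 * normc h ^+ 2 * expR (2 * `|freq n|)) =
     8 * normc h ^+ 2 * mag n * expR (3 * `|freq n|).
    have -> : 3 * `|freq n| = `|freq n| + 2 * `|freq n| by ring.
    by rewrite expRD; ring.
  have -> : 8 * (mag n * expR (4 * `|freq n|)) * normc h ^+ 2 =
    8 * normc h ^+ 2 * mag n * expR (4 * `|freq n|) by ring.
  rewrite ler_wpM2l ?mulr_ge0 ?sqr_ge0 ?mag_ge0// ler_expR.
  by rewrite ler_wpM2r// ler_nat.
- move=> n; rewrite Normc.normcM normc_imag.
  have t1 := normc_term_le e n (ltW z1); rewrite mul1r in t1.
  have t2 : `|freq n| <= expR `|freq n|.
    by have := expR_ge1Dx `|freq n|; lra.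
  apply: le_trans (ler_pM (normr_ge0 _) (normc_ge0 _) t2 t1) _.
  rewrite mulrCA -expRD.
  have : mag n * expR (`|freq n| + `|freq n|) <= mag n * expR (4 * `|freq n|).
    by rewrite ler_wpM2l ?mag_ge0// ler_expR; have := f0 n; lra.
  have : 0 <= mag n * expR (4 * `|freq n|) by rewrite mulr_ge0 ?mag_ge0 ?expR_ge0.
  lra.
- move=> K; rewrite -mulr_sumr ler_pM2l//; exact: mag_sum.
Qed.

Definition partner e z : R[i] := cphi z * riesz e z.

Lemma inv1Dnorm_sqr x : (1 + `|x|)^-1 ^+ 2 <= (oneDsqr x)^-1.
Proof.
have x0 := normr_ge0 x.
have x1 : 0 < 1 + `|x| by lra.
have o1 : 0 < oneDsqr x by exact: lt_le_trans (oneDsqr_ge1 x).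
rewrite exprVn lef_pV2 ?posrE ?exprn_gt0//.
by rewrite /oneDsqr -(real_normK (num_real x)); nra.
Qed.

Lemma integral_sqr_le (g : R -> R[i]) (D : R) : 0 <= D ->
  (forall x, normc (g x) <= D * (1 + `|x|)^-1) ->
  (\int[mu]_x ((normc (g x)) ^+ 2)%:E <= (D ^+ 2 * pi)%:E)%E.
Proof.
move=> D0 gD; apply: le_integral_oneDsqrV; first exact: sqr_ge0.
move=> x; rewrite sqr_ge0 /=.
apply: (@le_trans _ _ ((D * (1 + `|x|)^-1) ^+ 2)).
  rewrite ler_sqr ?nnegrE ?normc_ge0//.
  by rewrite mulr_ge0// invr_ge0 addr_ge0.
by rewrite exprMn ler_wpM2l ?sqr_ge0// inv1Dnorm_sqr.
Qed.

Lemma H2_partner e : H2_strip (partner e).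
Proof.
split.
  move=> z z1; have := derivableM (@derivable_cphi R z) (@derivable_riesz e z z1).
  exact.
exists ((36 * expR 4 * expR 1) ^+ 2 * pi) => y y1.
apply: (@integral_sqr_le (fun t => partner e (Complex t y))).
  by rewrite !mulr_ge0 ?expR_ge0.
move=> x; rewrite /partner Normc.normcM mulrAC.
apply: ler_pM; rewrite ?normc_ge0//; first exact: normc_cphi_le.
by apply: normc_riesz_le => /=; lra.
Qed.

Lemma normc_partner e e' x :
  normc (partner e (Complex x 0)) = normc (partner e' (Complex x 0)).
Proof.
have x4 : `|complex.Im (Complex x 0)| <= 4 by rewrite /= normr0.
rewrite /partner !Normc.normcM; congr (_ * _).
apply: (csums_normc_eq (q := fun K => (3 ^ K)%N) (rieszP e x4) (rieszP e' x4)).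
  by move=> K; exact/ltnW/ltn_pow3.
move=> K; rewrite !sum_term !normc_prod; apply: eq_bigr => k _ /=.
rewrite /sg; case: (e k); case: (e' k) => //;
  by rewrite !mulN1r ?mul1r !mulNr sqrrN.
Qed.

Lemma sin_natM_pi (m : nat) : sin (m%:R * pi) = 0 :> R.
Proof.
elim: m => [|m IH]; first by rewrite mul0r sin0.
by rewrite -addn1 natrD mulrDl mul1r sinDpi IH oppr0.
Qed.

Definition node k : R := pi / (2 * lam k).

Lemma node_itv k : 0 < node k < pi.
Proof.
have l4 : 4 <= lam k :> R.
  by rewrite /lam exprS ler_peMr// exprn_ege1// ler1n.
have p0 := @pi_gt0 R; apply/andP; split; first by rewrite divr_gt0//; lra.
by rewrite ltr_pdivrMr; [nra|lra].
Qed.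

Lemma sin_lam_node k : sin (lam k * node k) = 1.
Proof.
have l0 := @lam_gt0 R k; rewrite (_ : _ * _ = pi / 2) ?sin_pihalf//.
by rewrite /node; field; lra.
Qed.

Lemma sin_lam_node0 j k : (k < j)%N -> sin (lam j * node k) = 0.
Proof.
move=> kj; have -> : lam j * node k = (2 * 4 ^ (j - k.+1))%:R * pi.
  have -> : lam j = lam k * 4 * 4 ^+ (j - k.+1) :> R.
    by rewrite /lam -[in LHS](subnKC kj) exprS exprD; ring.
  rewrite natrM natrX /node; have l0 := @lam_gt0 R k.
  by field; lra.
exact: sin_natM_pi.
Qed.

(** At this point all factors of index above [k] equal 1, so the partial products are eventually
    constant. *)
Lemma riesz_node e k : riesz e (Complex (node k) 0) =
  \prod_(j < k.+1) Complex 1 (sg (e j) * amp j * sin (lam j * node k)).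
Proof.
have x4 : `|complex.Im (Complex (node k) 0)| <= 4 by rewrite /= normr0.
apply: (csums_unique (q := fun K => (3 ^ K)%N) (rieszP e x4)).
  by move=> K; exact/ltnW/ltn_pow3.
exists k.+1 => K kK; rewrite sum_term -(subnKC kK) big_split_ord /=.
rewrite [X in _ * X]big1 ?mulr1// => i _.
by rewrite sin_lam_node0 ?mulr0//= addSn ltnS leq_addr.
Qed.

Lemma riesz0 e : riesz e 0 = 1.
Proof.
have x4 : `|complex.Im (0 : R[i])| <= 4 by rewrite /= normr0.
apply: (csums_unique (q := fun K => (3 ^ K)%N) (rieszP e x4)).
  by move=> K; exact/ltnW/ltn_pow3.
exists 0%N => K _; rewrite -[0]/(Complex 0 0) sum_term big1// => i _.
by rewrite mulr0 sin0 mulr0.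
Qed.

(** Both functions equal 1 at 0, which forces [c = 1]; the values at the nodes then give the signs
    one after another. *)
Lemma partner_proportional e e' (c : R[i]) :
  (forall z, strip z -> partner e z = c * partner e' z) -> e = e'.
Proof.
move=> H.
have H0 : c = 1.
  have := H 0; rewrite /strip /= normr0 ltr01 => /(_ isT).
  rewrite /partner !riesz0 -[0]/(Complex 0 0) cphi_real kern0 divff//.
  by rewrite !mulr1.
have Hk k : riesz e (Complex (node k) 0) = riesz e' (Complex (node k) 0).
  have := H (Complex (node k) 0); rewrite /strip /= normr0 ltr01 => /(_ isT).
  rewrite H0 mul1r /partner; apply: mulfI.
  (* The kernel factor can be cancelled: the cosine is less than 1 strictly between 0 and pi. *)
  have /andP[n0 n1] := node_itv k.
  rewrite cphi_real eq_complex /= negb_and; apply/orP; left.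
  apply: mulf_neq0 => //; rewrite kernE ?gt_eqF//.
  rewrite divr_gt0 ?exprn_gt0// subr_gt0 -cos0 ltr_cos// in_itv /=.
    by rewrite lexx pi_ge0.
  by rewrite !ltW.
(* The signs below [k] agree by induction, and the product of the earlier factors is nonzero since
   each has real part 1. Comparing imaginary parts of the last factors leaves the sign of index
   [k]. *)
apply/funext => k; elim/ltn_ind : k => k IH.
have := Hk k; rewrite !riesz_node !big_ord_recr /=.
have -> : \prod_(i < k) Complex 1 (sg (e i) * amp i * sin (lam i * node k)) =
  \prod_(i < k) Complex 1 (sg (e' i) * amp i * sin (lam i * node k)).
  by apply: eq_bigr => i _; rewrite IH.
set P := \prod_(i < k) _; have P0 : P != 0.
  by apply/prodf_neq0 => i _; rewrite eq_complex /= negb_and oner_eq0.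
move=> /(mulfI P0)[]; rewrite sin_lam_node !mulr1 => /mulIf; rewrite gt_eqF ?amp_gt0// => /(_ isT).
by rewrite /sg; case: (e k); case: (e' k) => //; lra.
Qed.

Lemma uncountable_partners : ~ countable (range partner).
Proof.
move=> /countable_injP[f finj].
have pinj e e' : f (partner e) = f (partner e') -> e = e'.
  move=> fe; have pe : partner e = partner e'.
    by apply: finj => //; rewrite inE; eexists.
  by apply: (@partner_proportional e e' 1) => z _; rewrite pe mul1r.
(* Cantor's diagonal: [d] differs at [n] from the sequence coded by [n], if there is one; the
   contradiction is at the code of [d] itself. *)
pose d n := `[< exists e, f (partner e) = n /\ e n = false >].
have := erefl (d (f (partner d))); rewrite {1}/d.
case: asboolP => [[e [/pinj -> ->]]//|H].
by move/esym => dn; apply: H; exists d.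
Qed.

End riesz_product.

(** * The Fourier transforms of the partners *)

Section fourier_side.
Context {R : realType}.
Notation mu := (@lebesgue_measure R).
Notation normc := (@Normc.normc R).
Notation mag := (@mag R).
Notation freq := (@freq R).
Implicit Types (e : nat -> bool) (n k K N : nat) (x y xi C : R).

Lemma kern_le4 x : `|kern x| <= 4.
Proof.
rewrite ger0_norm ?kern_ge0//; apply: (le_trans (kern_le x)).
by rewrite ler_piMr// oneDsqrV_le1.
Qed.

(** Multiplication by [exp(i freq n x)] translates the transform by [freq n]: term [n] is the
    Fourier integrand of phi at [xi - freq n]. *)
Lemma partner_cexpi e x xi : csums
  (fun n => Complex (coef e n * (2 * kern x * cos (x * (xi - freq n))))
                    (coef e n * (2 * kern x * - sin (x * (xi - freq n)))))
  (restrR (partner e) x * cexpi (- (x * xi))).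
Proof.
have x4 : `|complex.Im (Complex x 0)| <= 4 by rewrite /= normr0.
have := csumsMl (cphi (Complex x 0) * cexpi (- (x * xi))) (rieszP e x4).
rewrite (_ : _ * riesz _ _ = restrR (partner e) x * cexpi (- (x * xi))); last first.
  by rewrite /restrR /partner; ring.
congr csums; apply/funext => n; rewrite cphi_real /term /cexpi /cexp; simpc.
rewrite expR0 ?mul1r cosN sinN mulrBr cosB sinB (mulrC x (freq n)).
by congr Complex; ring.
Qed.

Lemma sum_coef e K : \sum_(0 <= n < K) `|coef e n| <= expR 1 :> R.
Proof.
apply: (@le_trans _ _ (\sum_(0 <= n < K) mag n * 1)).
  by apply: ler_sum => n _; rewrite normr_coef mulr1.
apply: mag_sum_le => n; rewrite -expR0 ler_expR mulr_ge0//.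
Qed.

Lemma normr_kernM x (t : R) : `|t| <= 1 -> `|2 * kern x * t| <= 8.
Proof.
move=> t1; rewrite normrM normrM (ger0_norm (_ : 0 <= 2))//.
have := kern_le4 x; have := normr_ge0 (kern x); have := normr_ge0 t; nra.
Qed.

Lemma fourier_trunc_Re e N xi :
  \sum_(0 <= n < K) coef e n * Rintegral mu `[- N%:R, N%:R]%classic
      (fun x => 2 * kern x * cos (x * (xi - freq n))) @[K --> \oo]
  --> complex.Re (fourier_trunc (restrR (partner e)) N xi).
Proof.
apply: (@Rintegral_series R (coef e) _ _ _ _ 8 (expR 1)).
- by move=> n; apply: continuous_kernM; exact: continuous_cos.
- by move=> n x; apply: normr_kernM; exact: cos_max.
- exact: sum_coef.
- by move=> x; exact: csums_cvg_Re (partner_cexpi e x xi).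
Qed.

(** Every term of the imaginary part is odd, so its integral over the symmetric segment vanishes. *)
Lemma fourier_trunc_Im e N xi :
  complex.Im (fourier_trunc (restrR (partner e)) N xi) = 0.
Proof.
have cs : continuous (fun y : R => - sin y).
  by move=> y; apply: cvgN; exact: continuous_sin.
have H : \sum_(0 <= n < K) coef e n * Rintegral mu `[- N%:R, N%:R]%classic
      (fun x => 2 * kern x * - sin (x * (xi - freq n))) @[K --> \oo]
  --> complex.Im (fourier_trunc (restrR (partner e)) N xi).
  apply: (@Rintegral_series R (coef e) _ _ _ _ 8 (expR 1)).
  - by move=> n; exact: (continuous_kernM (t := fun y => - sin y)).
  - by move=> n x; apply: normr_kernM; rewrite normrN; exact: sin_max.
  - exact: sum_coef.
  - by move=> x; exact: csums_cvg_Im (partner_cexpi e x xi).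
move: H; rewrite (_ : (fun _ => _) = fun=> 0).
  by move=> H; have := cvg_unique _ H (cvg_cst (0 : R)); exact.
apply/funext => K; apply: big1 => n _; rewrite Rintegral_odd ?mulr0//.
  exact: (continuous_kernM (t := fun y => - sin y)).
by move=> x; rewrite kern_even mulNr sinN !mulrN opprK.
Qed.

(** The candidate transform, a sum of translated tents; [spectrum_cvg] shows that [limn] is an
    actual limit. *)
Definition spectrum C e xi : R[i] :=
  Complex (limn (fun K => \sum_(0 <= n < K) coef e n * tent C (xi - freq n))) 0.

Lemma inv1Dnorm_freq xi n :
  (1 + `|xi - freq n|)^-1 <= expR (4 * `|freq n|) * (1 + `|xi|)^-1.
Proof.
apply: (le_trans (inv1Dnorm_shift xi (freq n))).
have f0 := normr_ge0 (freq n).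
rewrite ler_wpM2r ?invr_ge0 ?addr_ge0//.
by apply: le_trans (expR_ge1Dx _) _; rewrite ler_expR; lra.
Qed.

(** Decay in [xi] survives summation: the cost of each translation is absorbed by the weight in
    [mag_sum]. Applied to the tents it bounds the spectrum; applied to the truncation errors it
    gives L2 convergence. *)
Lemma sum_coef_le e (d : nat -> R) (D : R) xi K : 0 <= D ->
  (forall n, `|d n| <= D * (1 + `|xi - freq n|)^-1) ->
  `|\sum_(0 <= n < K) coef e n * d n| <= D * expR 1 * (1 + `|xi|)^-1.
Proof.
move=> D0 dD; apply: (le_trans (ler_norm_sum _ _ _)).
apply: (@le_trans _ _ (D * (1 + `|xi|)^-1 *
   \sum_(0 <= n < K) mag n * expR (4 * `|freq n|))).
  rewrite mulr_sumr; apply: ler_sum => n _.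
  rewrite normrM normr_coef mulrCA ler_wpM2l ?mag_ge0//.
  apply: (le_trans (dD n)); rewrite -mulrA ler_wpM2l//.
  by rewrite mulrC; exact: inv1Dnorm_freq.
rewrite mulrAC; apply: ler_wpM2r; first by rewrite invr_ge0 addr_ge0.
by apply: ler_wpM2l => //; exact: mag_sum.
Qed.

Lemma spectrum_cvg C e xi :
  \sum_(0 <= n < K) coef e n * tent C (xi - freq n) @[K --> \oo] -->
  complex.Re (spectrum C e xi).
Proof.
apply: (@cvgn_series_le R _ (fun n => 8 * `|C| * mag n) (8 * `|C| * expR 1)).
  move=> n; rewrite normrM normr_coef mulrC ler_wpM2r ?mag_ge0//.
  apply: (le_trans (tent_le _ _)); rewrite ler_piMr ?mulr_ge0//.
  by rewrite invf_le1 ?lerDl// (lt_le_trans ltr01)// lerDl.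
move=> K; rewrite -mulr_sumr ler_wpM2l ?mulr_ge0//.
by under eq_bigr do rewrite -(normr_coef (fun=> true)); exact: sum_coef.
Qed.

Lemma normr_sum_disjoint (a : nat -> R) K :
  (forall n m, n != m -> a n = 0 \/ a m = 0) ->
  `|\sum_(0 <= n < K) a n| = \sum_(0 <= n < K) `|a n|.
Proof.
move=> a0; elim: K => [|K IH]; first by rewrite !big_geq// normr0.
rewrite !big_nat_recr//=; have [aK|aK] := eqVneq (a K) 0.
  by rewrite aK normr0 !addr0.
have z n : (n < K)%N -> a n = 0.
  move=> nK; have nK' : n != K by rewrite ltn_eqF.
  by case: (a0 n K nK') => // /eqP; rewrite (negbTE aK).
rewrite [X in `|X + _|]big_nat_cond [X in _ = X + _]big_nat_cond !big1 ?add0r//.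
  by move=> n /andP[/andP[_ nK] _]; rewrite z// normr0.
by move=> n /andP[/andP[_ nK] _]; rewrite z.
Qed.

(** The tents vanish outside [[-1, 1]] and the frequencies are 4 apart, so at most one term is
    nonzero at [xi], and the modulus passes inside the sum. *)
Lemma normc_spectrum C e e' xi :
  normc (spectrum C e xi) = normc (spectrum C e' xi).
Proof.
have disj e1 n m : n != m -> coef e1 n * tent C (xi - freq n) = 0 \/
    coef e1 m * tent C (xi - freq m) = 0.
  move=> nm; have := @freq_separated R _ _ nm.
  have [h|h] := leP 1 `|xi - freq n|.
    by left; rewrite tent_eq0// mulr0.
  have [h'|h' sep] := leP 1 `|xi - freq m|.
    by right; rewrite tent_eq0// mulr0.
  have := ler_normB (xi - freq m) (xi - freq n).
  by rewrite (_ : xi - freq m - _ = freq n - freq m); [lra|ring].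
(* The sequence on the left is free of [e1], so uniqueness of limits concludes. *)
have H e1 : \sum_(0 <= n < K) mag n * `|tent C (xi - freq n)| @[K --> \oo] -->
    normc (spectrum C e1 xi).
  rewrite [normc _]normc_real.
  have <- : (fun K => `|\sum_(0 <= n < K) coef e1 n * tent C (xi - freq n)|) =
      (fun K => \sum_(0 <= n < K) mag n * `|tent C (xi - freq n)|).
    apply/funext => K; rewrite normr_sum_disjoint.
      by apply: eq_bigr => n _; rewrite normrM normr_coef.
    exact: disj.
  exact: cvg_norm (@spectrum_cvg C e1 xi).
by have := cvg_unique _ (H e) (H e'); exact.
Qed.

Lemma measurable_spectrum C e :
  measurable_fun [set: R] (fun xi => complex.Re (spectrum C e xi)).
Proof.
apply/measurable_EFinP.
apply: (@emeasurable_fun_cvg _ _ R setT (fun K xi =>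
  (\sum_(0 <= n < K) coef e n * tent C (xi - freq n))%:E)) => //.
  move=> K; apply/measurable_EFinP; apply: continuous_measurable_fun.
  apply: (@continuous_sum_scale R (coef e) (fun n xi => tent C (xi - freq n))).
  move=> n x; apply: (@continuous_comp _ _ _ (fun xi => xi - freq n) (tent C)).
    by apply: cvgB; [exact: cvg_id|exact: cvg_cst].
  exact: continuous_tent.
by move=> xi _; apply: cvg_EFin; [exact: nearW|exact: spectrum_cvg].
Qed.

Lemma normc_spectrum_le C e xi :
  normc (spectrum C e xi) <= 8 * `|C| * expR 1 * (1 + `|xi|)^-1.
Proof.
rewrite [normc _]normc_real -[limn _]subr0.
apply: (cvgn_dist_le (@spectrum_cvg C e xi) (@cvg_cst _ (0 : R) nat \oo _)) => K.
rewrite subr0; apply: sum_coef_le; first by rewrite mulr_ge0.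
by move=> n; exact: tent_le.
Qed.

(** [C] depends on the kernel alone and precedes [e], which allows two partners to be compared. The
    pointwise truncation error is of order [1 / (N (1 + |xi|))], so its squared L2 norm is of order
    [N^-2]. *)
Lemma spectrum_fourier : exists C : R, forall e,
  is_L2_fourier (restrR (partner e)) (spectrum C e).
Proof.
have [C [c [c0 Hc]]] := @fourier_trunc_kern_tent R.
exists C => e; split.
- exact: measurable_spectrum.
- exact: measurable_cst.
- apply: (@le_lt_trans _ _ (((8 * `|C| * expR 1) ^+ 2 * pi)%:E)); last exact: ltry.
  apply: integral_sqr_le; first by rewrite !mulr_ge0 ?expR_ge0.
  by move=> xi; exact: normc_spectrum_le.
have diff N xi : (0 < N)%N ->
    normc (spectrum C e xi - fourier_trunc (restrR (partner e)) N xi) <=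
    c / N%:R * expR 1 * (1 + `|xi|)^-1.
  move=> N0.
  have -> : spectrum C e xi - fourier_trunc (restrR (partner e)) N xi =
    Complex (complex.Re (spectrum C e xi) -
      complex.Re (fourier_trunc (restrR (partner e)) N xi)) 0.
    have := fourier_trunc_Im e N xi; case: (fourier_trunc _ _ _) => a b /= ->.
    by rewrite /spectrum; simpc.
  rewrite normc_real.
  apply: (cvgn_dist_le (@spectrum_cvg C e xi) (@fourier_trunc_Re e N xi)) => K.
  rewrite -sumrB; under eq_bigr do rewrite -mulrBr.
  apply: sum_coef_le; first by rewrite divr_ge0.
  by move=> n; rewrite distrC; exact: Hc.
have cvg0 : (((c / N%:R * expR 1) ^+ 2 * pi)%:E : \bar R) @[N --> \oo] --> 0%E.
  apply: cvg_EFin; first exact: nearW.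
  have i0 : (N%:R^-1 : R) @[N --> \oo] --> (0 : R).
    by rewrite -cvg_shiftS; exact: cvg_harmonic.
  have q0 : c / N%:R * expR 1 @[N --> \oo] --> c * 0 * expR 1.
    by apply: cvgM; [apply: cvgM; [exact: cvg_cst|exact: i0]|exact: cvg_cst].
  have := cvgM (cvgM q0 q0) (@cvg_cst _ (pi : R) nat \oo _).
  by rewrite mulr0 !mul0r => H; exact: H.
apply: (@squeeze_cvge _ _ _ _ (cst 0%E) _
  (fun N : nat => ((c / N%:R * expR 1) ^+ 2 * pi)%:E)) => //; last exact: cvg_cst.
(* At [N = 0] the quotient [c / N%:R] is 0 by convention and bounds nothing; the comparison starts
   at 1. *)
exists 1%N => // N /= N0; apply/andP; split.
  by apply: integral_ge0 => x _; rewrite lee_fin sqr_ge0.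
apply: (@integral_sqr_le R (fun xi => spectrum C e xi -
  fourier_trunc (restrR (partner e)) N xi) (c / N%:R * expR 1)).
  by rewrite !mulr_ge0 ?expR_ge0 ?invr_ge0.
by move=> xi; exact: diff.
Qed.

End fourier_side.

Theorem theorem4p2 (R : realType) :
  exists f : R[i] -> R[i], H2_strip f /\
    exists P : set (R[i] -> R[i]),
      ~ countable P /\
      (forall g, P g -> H2_strip g /\ pauli_partner f g) /\
      (forall g1 g2, P g1 -> P g2 -> g1 <> g2 ->
         ~ exists c : R[i], forall z, strip z -> g1 z = c * g2 z).
Proof.
exists (partner (fun=> true)); split; first exact: H2_partner.
exists (range partner); split; [exact: uncountable_partners|split].
- move=> _ [e _ <-]; split; first exact: H2_partner.
  split; first by move=> x; exact: normc_partner.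
  (* One constant [C] serves both transforms. *)
  have [C HC] := @spectrum_fourier R.
  exists (spectrum C (fun=> true)), (spectrum C e); split => // xi.
  exact: normc_spectrum.
- move=> _ _ [e1 _ <-] [e2 _ <-] ne [c Hc]; apply: ne; congr partner.
  exact: partner_proportional Hc.
Qed.
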